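(* Let $\Gamma\subset\mathbb{P}^3$ be the 1-skeleton of the hemi-hypercube $\{4,3,3\}/2$ in real projective 3-space, let $c$ be a chiral colouring of $\Gamma$ with four colours, and let $\mathcal{Q}$ be the 4-polytope of type $\{4,3,3\}$ in $\mathbb{P}^3$ whose vertices and edges are those of $\Gamma$, whose 2-faces are the connected components of the subgraphs of $\Gamma$ formed by the edges of exactly two given colours, and whose facets (3-faces) are the connected components of the subgraphs formed by the edges of exactly three given colours. Then: (i) $\mathcal{Q}$ is combinatorially isomorphic to the hemi-hypercube $\{4,3,3\}/2$ (that is, their face posets are isomorphic); (ii) $\mathcal{Q}$ is geometrically chiral in $\mathbb{P}^3$; (iii) every facet of $\mathcal{Q}$ is geometrically chiral in $\mathbb{P}^3$.
   Context: **Projective space.** $\mathbb{P}^3$ is the set of lines through the origin of $\mathbb{R}^4$, i.e. the quotient of the unit sphere $\mathbb{S}^3$ by the antipodal map, with the induced metric. Its isometries are those induced by the orthogonal group, i.e. the group $O(4)/\{\pm I\}$. **The hemi-hypercube and its graph.** The hypercube $\{4,3,3\}$ is the 4-cube with vertex set $\{\pm1\}^4\subset\mathbb{R}^4$. The hemi-hypercube $\{4,3,3\}/2$ is its quotient by the central inversion $x\mapsto -x$: its face poset is the face poset of the 4-cube with each proper face identified with its antipodal face (so there are 8 vertices, 16 edges, 12 square 2-faces and 4 cubical facets, together with a least and a greatest face). It lives in $\mathbb{P}^3$. Its vertices are the 8 points $[x]$ with $x\in\{\pm1\}^4$, where $[x]=[-x]$. Its edges are the 16 shortest geodesic segments joining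 $[x]$ and $[y]$, where $y$ is obtained from $x$ by changing the sign of exactly one coordinate $i\in\{1,2,3,4\}$; this $i$ is called the direction of the edge. The resulting graph $\Gamma$ (the 1-skeleton) is isomorphic to the complete bipartite graph $K_{4,4}$. **Chiral colourings.** A chiral colouring of $\Gamma$ is an assignment of one of four colours to each edge of $\Gamma$ such that each colour class is a perfect matching of $\Gamma$ (four pairwise disjoint edges covering all vertices) and each colour class contains exactly one edge in each of the four directions. Up to renaming the colours there are exactly two chiral colourings; the polytopes they give are the two enantiomorphic (mirror image) forms. **Face poset of $\mathcal{Q}$.** The faces of $\mathcal{Q}$ are: a least face of rank $-1$; the vertices (rank 0) and edges (rank 1) of $\Gamma$; the 2-faces and 3-faces described in the claim, regarded as subgraphs of $\Gamma$; and a greatest face of rank 4 (all of $\Gamma$). They are ordered by inclusion. A flag is a maximal chain of faces. Two flags are adjacent if they differ in exactly one face. Each facet $F$ of $\mathcal{Q}$ is itself regarded as a polytope of rank 3 in $\mathbb{P}^3$, whose faces are the faces of $\mathcal{Q}$ contained in $F$. **Geometric chirality.** Let the polytope be either $\mathcal{Q}$ or one of its facets, realised in $\mathbb{P}^3$ with its vertices being points $[x]$, its edges being geodesic segments of $\Gamma$, and its faces of higher rank being subgraphs of $\Gamma\subset\mathbb{P}^3$. A symmetry of the polytope is an isometry of $\mathbb{P}^3$ that maps the set of faces of each rank of the polytope onto itself. The polytope is geometrically chiral if the action of its symmetry group on its set of flags has exactly two orbits and any two adjacent flags lie in different orbits. *)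

(* Defs.v *)
(* MathComp, with the classical sets and the realType of MathComp-Analysis *)
From Stdlib Require Import Relation_Operators.
From mathcomp Require Import all_boot all_order all_algebra.
From mathcomp Require Import boolp classical_sets functions reals.
Set Implicit Arguments.
Unset Strict Implicit.
Unset Printing Implicit Defensive.

Import Order.TTheory GRing.Theory Num.Theory.
Local Open Scope ring_scope.

(* A vertex of the 4-cube {1, -1}^4; the coordinate i is (-1) ^+ x i. *)
Definition signs := {ffun 'I_4 -> bool}.

Definition antipode (x : signs) : signs := [ffun i => ~~ x i].

Definition flip (x : signs) (i : 'I_4) : signs :=
  [ffun j => if j == i then ~~ x j else x j].

(* Faces of the 4-cube are given by their vertex sets: a nonempty face is
   obtained by prescribing the signs of some of the coordinates. *)
Definition subcube (s : {ffun 'I_4 -> option bool}) : {set signs} :=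
  [set x : signs | [forall i, (s i == None) || (s i == Some (x i))]]%SET.

Definition cube_face (F : {set signs}) : Prop :=
  F = finset.set0 \/ exists s, F = subcube s.

(* The class of a face under the central inversion; the empty face and the
   cube itself are centrally symmetric, so only proper faces get identified. *)
Definition antipodal_class (F : {set signs}) : {set {set signs}} :=
  [set F; [set antipode x | x in F]]%SET.

Definition hemicube_le (A B : {set {set signs}}) : Prop :=
  exists F G, [/\ F \in A, G \in B & F \subset G].

Local Open Scope classical_set_scope.

Definition hemicube_face : set {set {set signs}} :=
  [set antipodal_class F | F in cube_face].

Definition poset_isomorphic (T U : Type) (A : set T) (leT : T -> T -> Prop)
    (B : set U) (leU : U -> U -> Prop) : Prop :=
  exists f : T -> U, set_bij A B f /\
    forall x y, A x -> A y -> (leT x y <-> leU (f x) (f y)).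

(* Points of P^3 are the lines through the origin of R^4. *)
Definition proj3 (R : realType) :=
  {L : {vspace 'rV[R]_4} | \dim L == 1%N}.

Definition induced_by (R : realType) (A : 'M[R]_4) (f : proj3 R -> proj3 R) :=
  forall p, val (f p) = (linfun (mulmxr A) @: val p)%VS.

Definition isometry3 (R : realType) (f : proj3 R -> proj3 R) : Prop :=
  exists A : 'M[R]_4, A *m A^T = 1%:M /\ induced_by A f.

Definition vec (R : realType) (x : signs) : 'rV[R]_4 := \row_i (-1) ^+ x i.

(* The image in P^3 of the straight segment from v to w. When v and w have the
   same norm and a positive inner product, it is the unique shortest geodesic
   segment between their classes; this applies to the vertices v and w of an
   edge of the 4-cube, whose inner product is 2. *)
Definition segment (R : realType) (v w : 'rV[R]_4) : set (proj3 R) :=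
  [set p | exists2 t : R, 0 <= t <= 1 &
             val p = <[(1 - t) *: v + t *: w]>%VS].

Definition gamma_vertex (R : realType) : set (proj3 R) :=
  [set p | exists x, val p = <[vec R x]>%VS].

Definition edge_in_direction (R : realType) (i : 'I_4) :
    set (set (proj3 R)) :=
  [set e | exists x, e = segment (vec R x) (vec R (flip x i))].

Definition gamma_edge (R : realType) : set (set (proj3 R)) :=
  [set e | exists i, edge_in_direction i e].

(* A subgraph of Gamma: its vertices, and its edges as point sets. The
   endpoints of an edge e are the vertices of Gamma lying on e. *)
Record subgraph (R : realType) := Subgraph {
  vertices : set (proj3 R);
  edges : set (set (proj3 R)) }.

Definition subgraph_le (R : realType) (G H : subgraph R) : Prop :=
  vertices G `<=` vertices H /\ edges G `<=` edges H.

Definition gamma (R : realType) : subgraph R :=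
  Subgraph (@gamma_vertex R) (@gamma_edge R).

Definition edge_induced (R : realType) (E : set (set (proj3 R))) :=
  Subgraph [set v | gamma_vertex v /\ exists2 e, E e & e v] E.

Definition adjacent (R : realType) (G : subgraph R) (v w : proj3 R) : Prop :=
  [/\ vertices G v, vertices G w & exists e, [/\ edges G e, e v & e w]].

Definition connected (R : realType) (G : subgraph R) :=
  clos_refl_trans (proj3 R) (adjacent G).

Definition component (R : realType) (G H : subgraph R) : Prop :=
  exists2 v, vertices G v &
    H = Subgraph [set w | connected G v w]
          [set e | edges G e /\ exists2 w, connected G v w & e w].

(* Colourings are total functions on sets of points; only their values on the
   edges of Gamma are ever used. *)
Definition colour_class (R : realType) (c : set (proj3 R) -> 'I_4) (k : 'I_4) :
    set (set (proj3 R)) :=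
  [set e | gamma_edge e /\ c e = k].

Definition perfect_matching (R : realType) (M : set (set (proj3 R))) : Prop :=
  M `<=` @gamma_edge R /\
  forall v, gamma_vertex v -> exists! e, M e /\ e v.

Definition chiral_colouring (R : realType) (c : set (proj3 R) -> 'I_4) : Prop :=
  forall k, perfect_matching (colour_class c k) /\
    forall i, exists! e, colour_class c k e /\ edge_in_direction i e.

Definition colour_subgraph (R : realType) (c : set (proj3 R) -> 'I_4)
    (S : {set 'I_4}) : subgraph R :=
  edge_induced [set e | gamma_edge e /\ c e \in S].

Definition colour_component (R : realType) (c : set (proj3 R) -> 'I_4)
    (n : nat) : set (subgraph R) :=
  [set F | exists S : {set 'I_4}, #|S| = n /\ component (colour_subgraph c S) F].

(* The faces of each rank; Negz 0 is the rank -1. *)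
Definition Qface (R : realType) (c : set (proj3 R) -> 'I_4) (r : int) :
    set (subgraph R) :=
  match r with
  | Negz 0 => [set Subgraph set0 set0]
  | Posz 0 => [set Subgraph [set v] set0 | v in @gamma_vertex R]
  | Posz 1 => [set edge_induced [set e] | e in @gamma_edge R]
  | Posz 2 => colour_component c 2
  | Posz 3 => colour_component c 3
  | Posz 4 => [set gamma R]
  | _ => set0
  end.

Definition facet_face (R : realType) (c : set (proj3 R) -> 'I_4)
    (F : subgraph R) (r : int) : set (subgraph R) :=
  [set G | Qface c r G /\ subgraph_le G F].

(* In what follows P gives the set of faces of each rank of a polytope. *)
Definition all_faces (R : realType) (P : int -> set (subgraph R)) :
    set (subgraph R) :=
  [set F | exists r, P r F].

Definition chain (R : realType) (P : int -> set (subgraph R))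
    (C : set (subgraph R)) : Prop :=
  C `<=` all_faces P /\ total_on C (@subgraph_le R).

Definition flag (R : realType) (P : int -> set (subgraph R)) :
    set (set (subgraph R)) :=
  [set C | chain P C /\ forall D, chain P D -> C `<=` D -> D = C].

Definition adjacent_flags (R : realType) (C D : set (subgraph R)) : Prop :=
  exists F G, C `\` D = [set F] /\ D `\` C = [set G].

Definition move (R : realType) (f : proj3 R -> proj3 R) (G : subgraph R) :=
  Subgraph (f @` vertices G) [set f @` e | e in edges G].

Definition symmetry (R : realType) (P : int -> set (subgraph R)) :
    set (proj3 R -> proj3 R) :=
  [set f | isometry3 f /\ forall r, move f @` P r = P r].

Definition orbit (R : realType) (P : int -> set (subgraph R))
    (C : set (subgraph R)) : set (set (subgraph R)) :=
  [set move f @` C | f in symmetry P].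

Definition flag_orbits (R : realType) (P : int -> set (subgraph R)) :
    set (set (set (subgraph R))) :=
  [set orbit P C | C in flag P].

Definition geometrically_chiral (R : realType)
    (P : int -> set (subgraph R)) : Prop :=
  (exists O1 O2, O1 <> O2 /\ flag_orbits P = [set O1; O2]) /\
  forall C D, flag P C -> flag P D -> adjacent_flags C D ->
    orbit P C <> orbit P D.

(* Main.v *)
(* The vertices of Gamma are the sixteen sign vectors up to a common sign. An
   isometry that permutes them is induced by a signed permutation of the
   coordinates: the images of two adjacent vertices of the 4-cube are again
   sign vectors, and half their difference is a row of the matrix up to sign.

   The even vertices, the directions and the odd vertices are the rows, columns
   and symbols of a Latin square of order 4, of which a chiral colouring is an
   orthogonal mate. Once each colour is named after its direction at the vertex
   (1, 1, 1, 1), an exhaustive search leaves two colourings. For each of them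
   the walks along the four colours from that vertex turn Gamma into the
   hemi-hypercube with the colours as directions, which gives (i). For (ii) and
   (iii) the signed permutations that preserve the faces are enumerated: two
   flags in distinct orbits represent all the orbits, and neither of them is
   adjacent to a flag of its own orbit. Two adjacent flags of a common orbit
   could be moved so that one of them is one of these two flags. *)
From Stdlib Require Import Relation_Operators.
Require Import Defs.
From mathcomp Require Import all_boot all_order all_algebra.
From mathcomp Require Import boolp classical_sets functions reals.
Set Implicit Arguments.
Unset Strict Implicit.
Unset Printing Implicit Defensive.

(** The statement quantifies over colourings, isometries and maximal chains of subgraphs; each of
    these is cut down to a finite list before anything is computed. Colours: renaming them permutes
    the sets of two or of three colours, hence leaves the faces of Q unchanged, which is why only
    the normalized colourings matter. Isometries: there remain the 24 * 8 = 192 signed permutations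
    up to a global sign. The same list serves the facets: a facet is Gamma minus one colour class,
    so it still contains all eight vertices, and its symmetries permute the vertices of Gamma too.
    Parts (ii) and (iii) can therefore share one certificate. Flags: they are defined as maximal
    chains, with no reference to ranks. A check of gradedness on the lists of faces shows that a
    maximal chain has exactly one face of each rank, so that flags can be enumerated. For (i), the
    two posets are not compared with each other directly: both are parametrized by sign patterns,
    with one explicit order on these. *)

Fixpoint words (T : Type) (s : seq T) (n : nat) : seq (seq T) :=
  if n is m.+1 then [seq a :: w | a <- s, w <- words s m] else [:: [::]].

Lemma mem_words (T : eqType) (s : seq T) n w :
  (w \in words s n) = (size w == n) && all [in s] w.
Proof.
elim: n w => [|n IHn] [|a w] //=.
  by apply/allpairsP => -[[b v] []].
rewrite eqSS andbCA; apply/allpairsP/andP => [[[b v] /= [bs]]|[aS]].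
  by rewrite IHn => /andP[sv vs] [-> ->]; rewrite bs sv.
by rewrite -IHn => ws; exists (a, w).
Qed.

(** * Graded finite posets *)

Section GradedPosets.
Variables (T : eqType) (le : rel T).

Fixpoint flags_above (G : T) (rs : seq (seq T)) : seq (seq T) :=
  if rs is r :: rs' then
    flatten [seq [seq H :: s | s <- flags_above H rs'] | H <- r & le G H]
  else [:: [::]].

Definition flags (rs : seq (seq T)) : seq (seq T) :=
  if rs is r :: rs' then flatten [seq [seq G :: s | s <- flags_above G rs'] | G <- r]
  else [:: [::]].

Lemma mem_flags_above G rs s :
  (s \in flags_above G rs) = path le G s && all2 (fun H r => H \in r) s rs.
Proof.
elim: rs G s => [|r rs IH] G [|H s] //=; rewrite ?andbF //.
  by apply/flatten_mapP => -[K _ /mapP[]].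
apply/flatten_mapP/andP => [[K]|[/andP[GH Hs] /andP[Hr srs]]].
  rewrite mem_filter => /andP[GK Kr] /mapP[s' s'P [-> ->]].
  by move: s'P; rewrite IH => /andP[-> ->]; rewrite GK Kr.
by exists H; rewrite ?mem_filter ?GH //; apply/mapP; exists s; rewrite // IH Hs.
Qed.

Lemma mem_flags rs s :
  (s \in flags rs) = sorted le s && all2 (fun H r => H \in r) s rs.
Proof.
case: rs s => [|r rs] [|H s] //=; rewrite ?andbF //.
  by apply/flatten_mapP => -[K _ /mapP[]].
apply/flatten_mapP/idP => [[K Kr /mapP[s' s'P [-> ->]]]|/and3P[Hs Hr srs]].
  by move: s'P; rewrite mem_flags_above Kr.
by exists H => //; apply/mapP; exists s; rewrite // mem_flags_above Hs.
Qed.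

(** These conditions force a maximal chain to take exactly one face from each rank: there are a
    least and a greatest face in the extreme ranks, ranks increase along the order, and every rank
    between two comparable faces can be filled. The conditional spares the search for intermediate
    faces when [le G H] fails, which a boolean connective would not do under strict evaluation. *)
Definition graded (rs : seq (seq T)) : bool :=
  let ranks := iota 0 (size rs) in
  [&& has (fun G => all (le G) (flatten rs)) (nth [::] rs 0),
      has (fun H => all (le^~ H) (flatten rs)) (nth [::] rs (size rs).-1) &
      all (fun i => all (fun j => all (fun G => all (fun H =>
        if le G H then
          ((i < j) || (i == j) && (G == H)) &&
          all (fun k => has (fun K => le G K && le K H) (nth [::] rs k))
              (iota i.+1 (j - i.+1))
        else true)
        (nth [::] rs j)) (nth [::] rs i)) ranks) ranks].

End GradedPosets.

(** * The finite model *)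

(* Coordinate i of the point encoded by x is (-1) ^+ nth false x i. *)
Definition bits : seq (seq bool) := words [:: false; true] 4.

Definition bflip (x : seq bool) (i : nat) : seq bool :=
  mkseq (fun j => nth false x j (+) (j == i)) 4.
Definition bnorm (x : seq bool) : seq bool :=
  if nth false x 3 then map negb x else x.
Definition beven (x : seq bool) : bool := ~~ odd (count id x).

(* A vertex of Gamma is encoded by its representative with a positive last
   coordinate, and an edge by its direction and its even end: the parity of the
   number of negative coordinates is invariant under the antipodal map. *)
Definition bvertices : seq (seq bool) := [seq x <- bits | ~~ nth false x 3].
Definition bedge (x : seq bool) (i : nat) : seq bool * nat :=
  (bnorm (if beven x then x else bflip x i), i).
Definition bedges : seq (seq bool * nat) :=
  [seq (x, i) | x <- [seq x <- bvertices | beven x], i <- iota 0 4].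
Definition ends (e : seq bool * nat) : seq (seq bool) :=
  [:: e.1; bnorm (bflip e.1 e.2)].

Definition face := (seq (seq bool) * seq (seq bool * nat))%type.
(* Listing vertices and edges in a fixed order makes the equality of faces an
   equality of lists. *)
Definition canon (W : pred (seq bool)) (D : pred (seq bool * nat)) : face :=
  ([seq v <- bvertices | W v], [seq e <- bedges | D e]).
Definition face_le (G H : face) : bool :=
  all [in H.1] G.1 && all [in H.2] G.2.
Definition valid (G : face) : bool := G == canon [in G.1] [in G.2].

(* The pair (t, e) encodes the isometry that maps x to the point with
   coordinates (-1) ^+ e j * x (t j). *)
Definition act_bits (g : seq nat * seq bool) (x : seq bool) : seq bool :=
  mkseq (fun j => nth false x (nth 0 g.1 j) (+) nth false g.2 j) 4.
(** Position [j] of the image reads coordinate [t j], so directions are moved by the inverse of [t],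
    which [index] computes. *)
Definition act_edge (g : seq nat * seq bool) (e : seq bool * nat) :=
  bedge (act_bits g e.1) (index e.2 g.1).
Definition act_face (g : seq nat * seq bool) (G : face) : face :=
  let W := [seq bnorm (act_bits g v) | v <- G.1] in
  let D := [seq act_edge g e | e <- G.2] in
  canon [in W] [in D].

Definition coordinate_perms : seq (seq nat) :=
  [seq t <- words (iota 0 4) 4 | uniq t].

(* One of each pair of opposite matrices, since these induce the same map. *)
Definition signed_perms : seq (seq nat * seq bool) :=
  [seq (t, e) | t <- coordinate_perms, e <- bvertices].

Arguments bits : simpl never.
Arguments bvertices : simpl never.
Arguments bedges : simpl never.
Arguments coordinate_perms : simpl never.

(** Each rank is compared with its image as a set. Under strict evaluation the conditional skips the
    second inclusion when the first one fails. *)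
Definition preserves (g : seq nat * seq bool) (rs : seq (seq face)) : bool :=
  all (fun r => let r' := map (act_face g) r in
                if all [in r] r' then all [in r'] r else false) rs.

(* A necessary condition for the flags s and s' to be adjacent. *)
Definition almost_included (s s' : seq face) : bool :=
  size (undup [seq G <- s | G \notin s']) == 1.

(* The flags C1 and C2 represent the two orbits. *)
Definition chirality_certificate (rs : seq (seq face)) (C1 C2 : seq face) : bool :=
  let gs := [seq g <- signed_perms | preserves g rs] in
  let O1 := [seq map (act_face g) C1 | g <- gs] in
  let O2 := [seq map (act_face g) C2 | g <- gs] in
  let fs := flags face_le rs in
  [&& [&& all valid (flatten rs),
          nth [::] rs 1 == [seq canon (pred1 v) pred0 | v <- bvertices] &
          graded face_le rs],
      [&& C1 \in fs, C2 \in fs & all [predU [in O1] & [in O2]] fs],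
      all (fun C => ~~ all [in C] C2) O1,
      all (fun C => ~~ almost_included C1 C) O1 &
      all (fun C => ~~ almost_included C2 C) O2].

(** The second representative is the first flag outside the orbit of the first. If there were none,
    the default [[::]] would not be a flag and the certificate would fail. *)
Definition chiral_model (rs : seq (seq face)) : bool :=
  let gs := [seq g <- signed_perms | preserves g rs] in
  let fs := flags face_le rs in
  let C1 := head [::] fs in
  let O1 := [seq map (act_face g) C1 | g <- gs] in
  chirality_certificate rs C1 (head [::] [seq C <- fs | C \notin O1]).

(** * Search for the chiral colourings *)

(** Distinct edges in conflict cannot share a colour: a colour class has one edge in each direction,
    and it is a matching. Chiral colourings thus become proper colourings of a graph on the sixteen
    edges. *)
Definition conflict (e e' : seq bool * nat) : bool :=
  (e.2 == e'.2) || has [in ends e'] (ends e).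

(* The colourings of es with n colours that extend the partial colouring p and
   are proper for conflict. *)
Fixpoint extensions (n : nat) (es : seq (seq bool * nat)) (p : seq ((seq bool * nat) * nat)) :
    seq (seq ((seq bool * nat) * nat)) :=
  if es is e :: es' then
    flatten [seq extensions n es' ((e, k) :: p) | k <- iota 0 n &
       all (fun q => conflict e q.1 ==> (k != q.2)) p]
  else [:: p].

Definition base_edges : seq (seq bool * nat) :=
  [seq e <- bedges | e.1 == nseq 4 false].

(* The colours are named after the directions at the vertex (1, 1, 1, 1). *)
Definition normalized_colourings : seq (seq ((seq bool * nat) * nat)) :=
  extensions 4 [seq e <- bedges | e.1 != nseq 4 false] [seq (e, e.2) | e <- base_edges].

Definition colour_of (p : seq ((seq bool * nat) * nat)) (e : seq bool * nat) : nat :=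
  nth 0 (unzip2 p) (index e (unzip1 p)).

(** Completeness of the search: the branch that gives each edge its colour under [col] is never
    pruned. The list is reversed by [catrev] because [extensions] puts each newly coloured edge in
    front. *)
Lemma mem_extensions n (col : seq bool * nat -> nat) es q :
  uniq (es ++ q) -> {in es, forall e, col e < n} ->
  {in es ++ q &, forall e e', e != e' -> conflict e e' -> col e != col e'} ->
  [seq (e, col e) | e <- catrev es q] \in extensions n es [seq (e, col e) | e <- q].
Proof.
elim: es q => [|e es IH] q /=; first by rewrite inE.
move=> /andP[eNq uq] coln proper; apply/flatten_mapP; exists (col e).
  have en : col e < n by apply: coln; exact: mem_head.
  rewrite mem_filter mem_iota; apply/andP; split; last exact: en.
  apply/allP => _ /mapP[e' e'q ->] /=; apply/implyP; apply: proper.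
  - by rewrite mem_head.
  - by rewrite inE mem_cat e'q !orbT.
  - by apply: contraNneq eNq => ->; rewrite mem_cat e'q orbT.
have perm_eq_es : es ++ e :: q =i e :: es ++ q.
  by move=> e'; rewrite !inE !mem_cat inE orbCA.
apply: (IH (e :: q)).
- by rewrite -(cat1s e) uniq_catCA /= eNq uq.
- by move=> e' e'es; apply: coln; rewrite inE e'es orbT.
- by move=> e1 e2; rewrite !perm_eq_es; apply: proper.
Qed.

(** * Faces determined by a colouring *)

Section ColouredFaces.
Variable col : seq bool * nat -> nat.

Definition coloured_edges (M : seq bool) := [seq e <- bedges | nth false M (col e)].
Definition grow (D : seq (seq bool * nat)) (W : seq (seq bool)) :=
  [seq w <- bvertices | (w \in W) ||
     has (fun e => (w \in ends e) && has [in W] (ends e)) D].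
(* Three steps are enough to exhaust a square or a cube; see saturated. *)
Definition reach (D : seq (seq bool * nat)) v := iter 3 (grow D) [:: v].
Definition component_face (M : seq bool) (v : seq bool) : face :=
  let D := coloured_edges M in
  let W := reach D v in
  canon [in W] [pred e | (e \in D) && has [in W] (ends e)].
Definition masks n := [seq M <- bits | count id M == n].
Definition component_faces n : seq face :=
  undup [seq component_face M v | M <- masks n, v <- bvertices].
(** The list starts with the least face, so the faces of rank k stand at index k + 1. *)
Definition ranks : seq (seq face) :=
  [:: [:: canon pred0 pred0];
      [seq canon (pred1 v) pred0 | v <- bvertices];
      [seq canon [in ends e] (pred1 e) | e <- bedges];
      component_faces 2; component_faces 3; [:: canon predT predT]].
(** The ranks -1 to 3 are kept, and the facet itself becomes the greatest face. *)
Definition facet_ranks rs F : seq (seq face) :=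
  [seq [seq G <- r | face_le G F] | r <- take 5 rs].

(** Every vertex must lie on an edge of the chosen colours, so that the subgraph induced by these
    edges has all the vertices of Gamma; and [reach] must be a fixed point of [grow], so that it is
    a whole component. *)
Definition saturated n : bool :=
  all (fun M => let D := coloured_edges M in
    all (fun v => has (fun e => v \in ends e) D &&
                  let W := reach D v in grow D W == W) bvertices) (masks n).

(** The boolean is used as an index: 1 if [v] is the first end, 0 otherwise. *)
Definition other_end (e : seq bool * nat) (v : seq bool) : seq bool :=
  nth v (ends e) (v == e.1).
Definition edge_at (k : nat) (v : seq bool) : seq bool * nat :=
  head ([::], 0) [seq e <- bedges | (v \in ends e) && (col e == k)].
Definition walk (x : seq bool) : seq bool :=
  foldl (fun v k => if nth false x k then other_end (edge_at k v) v else v)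
    (nseq 4 false) (iota 0 4).
Definition in_code (s : seq (option bool)) (x : seq bool) : bool :=
  all2 (fun a b => (a == None) || (a == Some b)) s x.
(* Since any two colours form squares, the steps of a walk commute, and the
   vertex walk x of Gamma plays the role of the vertex x of the 4-cube. *)
Definition code_face (s : seq (option bool)) : face :=
  let W := [seq walk x | x <- bits & in_code s x] in
  let D := [seq edge_at k v | k <- [seq k <- iota 0 4 | nth None s k == None], v <- W] in
  canon [in W] [in D].
End ColouredFaces.

(* A face of the 4-cube is encoded by its prescribed coordinates. *)
Definition codes : seq (seq (option bool)) := words [:: None; Some false; Some true] 4.
Definition code_opp (s : seq (option bool)) := map (omap negb) s.
Definition code_le (s t : seq (option bool)) : bool :=
  all2 (fun a b => (b == None) || (b == a)) s t.
(* One of each pair of antipodal faces; None is the empty face. *)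
Definition code_reps : seq (option (seq (option bool))) :=
  None :: [seq Some s | s <- codes & head (Some false) (filter isSome s) == Some false].

Definition hemi_le (s t : option (seq (option bool))) : bool :=
  if s is Some s' then
    if t is Some t' then code_le s' t' || code_le s' (code_opp t') else false
  else true.

Definition hemi_face (col : seq bool * nat -> nat) (s : option (seq (option bool))) : face :=
  if s is Some s' then code_face col s' else canon pred0 pred0.

(** The pairs tabulate [a], so that each face is computed once. Injectivity of [a] follows from the
    agreement of the two orders, because [hemi_le] is antisymmetric on [code_reps]. *)
Definition code_model (a : option (seq (option bool)) -> face) (rs : seq (seq face)) : bool :=
  let cf := [seq (s, a s) | s <- code_reps] in
  let L := flatten rs in
  [&& all [in L] (unzip2 cf), all [in unzip2 cf] L &
      all (fun p => all (fun q => face_le p.2 q.2 == hemi_le p.1 q.1) cf) cf].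

Arguments codes : simpl never.
Arguments code_reps : simpl never.

Lemma code_reps_complete s :
  s \in codes -> (Some s \in code_reps) || (Some (code_opp s) \in code_reps).
Proof. by apply/allP: s; vm_compute. Qed.

Lemma code_reps_codes s : Some s \in code_reps -> s \in codes.
Proof.
have : all (fun t => if t is Some t' then t' \in codes else true) code_reps.
  by vm_compute.
by move=> /allP/(_ (Some s)).
Qed.

Lemma hemi_le_refl s : s \in code_reps -> hemi_le s s.
Proof. by apply/allP: s; vm_compute. Qed.

Lemma hemi_le_anti : {in code_reps &, forall s t, hemi_le s t && hemi_le t s -> s = t}.
Proof.
have : all (fun s => all (fun t => hemi_le s t && hemi_le t s ==> (s == t)) code_reps)
  code_reps by vm_compute.
by move=> /allP H s t /H/allP{}H /H/implyP{}H /H/eqP.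
Qed.

(** By the first condition the greatest face of Q is not contained in [F], so that the rank omitted
    from [facet_ranks] is indeed empty in the facet. *)
Definition facet_model (rs : seq (seq face)) (F : face) : bool :=
  all (fun H => ~~ face_le H F) (nth [::] rs 5) && chiral_model (facet_ranks rs F).

Definition colouring_model (col : seq bool * nat -> nat) : bool :=
  let rs := ranks col in
  [&& saturated col 2, saturated col 3, code_model (hemi_face col) rs, chiral_model rs &
      all (facet_model rs) (nth [::] rs 4)].

Lemma normalized_colouring_models :
  all (fun p => colouring_model (colour_of p)) normalized_colourings.
(* The whole enumeration is this one evaluation; the unchecked cast leaves it to [Qed], so that it
   runs only once. *)
Proof. by vm_cast_no_check (erefl true). Qed.

(** * Isometries of the projective space and vertices of the cube *)

Section Geometry.
Import Order.TTheory GRing.Theory Num.Theory.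
Local Open Scope classical_set_scope.
Local Open Scope ring_scope.
Variable R : realType.
Implicit Types (x y : signs) (i j : 'I_4) (v w : 'rV[R]_4) (p : proj3 R).

Lemma vec_antipode x : vec R (antipode x) = - vec R x.
Proof. by apply/rowP => i; rewrite !mxE ffunE signrN. Qed.

Lemma vec_inj : injective (@vec R).
Proof.
by move=> x y /rowP E; apply/ffunP => i; have := E i; rewrite !mxE => /signr_inj.
Qed.

Lemma vec_neq0 x : vec R x != 0.
Proof.
apply/eqP => /rowP/(_ ord0); rewrite !mxE => /eqP.
by rewrite signr_eq0.
Qed.

Lemma vec_colinear x y k : vec R x = k *: vec R y -> x = y \/ x = antipode y.
Proof.
move=> E; have /rowP/(_ ord0) := E; rewrite !mxE => E0.
have {E0} Ek : k = (-1) ^+ (x ord0 (+) y ord0).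
  by rewrite signr_addb E0 -mulrA -expr2 sqrr_sign mulr1.
case Eb: (x ord0 (+) y ord0) Ek => -> in E *.
  by right; apply: vec_inj; rewrite vec_antipode E expr1 scaleN1r.
by left; apply: vec_inj; rewrite E expr0 scale1r.
Qed.

Lemma vline_opp v : <[- v]>%VS = <[v]>%VS.
Proof.
apply/eqP; rewrite eqEsubv -!memvE memvN memv_line /=.
by rewrite -memvN memv_line.
Qed.

Lemma proj3_line p : exists2 v, v != 0 & val p = <[v]>%VS.
Proof.
have /eqP dimp := valP p; exists (vpick (val p)).
  by rewrite vpick0 -dimv_eq0 dimp.
apply/eqP; rewrite eq_sym eqEdim -memvE memv_pick dimp dim_vline lt0b.
by rewrite vpick0 -dimv_eq0 dimp.
Qed.

Lemma limg_mulmx (A : 'M[R]_4) v :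
  (linfun (mulmxr A) @: <[v]>)%VS = <[v *m A]>%VS.
Proof. by rewrite limg_line lfunE. Qed.

Lemma induced_line (A : 'M[R]_4) (f : proj3 R -> proj3 R) p v :
  induced_by A f -> val p = <[v]>%VS -> val (f p) = <[v *m A]>%VS.
Proof. by move=> -> ->; rewrite limg_mulmx. Qed.

Lemma induced_exists (A : 'M[R]_4) :
  A \in unitmx -> exists f : proj3 R -> proj3 R, induced_by A f.
Proof.
move=> uA; have dimA p : \dim (linfun (mulmxr A) @: val p)%VS == 1%N.
  have [v v0 ->] := proj3_line p; rewrite limg_mulmx dim_vline.
  suff -> : v *m A != 0 by [].
  by apply: contra v0 => /eqP E; rewrite -[v](mulmxK uA) E mul0mx.
by by exists (fun p => exist (fun L => is_true (\dim L == 1%N)) _ (dimA p)).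
Qed.

Lemma induced_opp (A : 'M[R]_4) (f : proj3 R -> proj3 R) :
  induced_by A f -> induced_by (- A) f.
Proof.
move=> fA p; have [v _ E] := proj3_line p.
rewrite (induced_line fA E) E limg_mulmx mulmxN.
by rewrite vline_opp.
Qed.

Lemma induced_comp (A B : 'M[R]_4) (f g : proj3 R -> proj3 R) :
  induced_by A f -> induced_by B g -> induced_by (A *m B) (g \o f).
Proof.
move=> fA gB p; have [v _ E] := proj3_line p.
by rewrite (induced_line gB (induced_line fA E)) E limg_mulmx mulmxA.
Qed.

Lemma induced_inj (A : 'M[R]_4) (f g : proj3 R -> proj3 R) :
  induced_by A f -> induced_by A g -> f = g.
Proof. by move=> fA gA; apply: funext => p; apply: val_inj; rewrite /= fA gA. Qed.

Lemma induced_id : induced_by (1%:M : 'M[R]_4) (@id (proj3 R)).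
Proof. by move=> p; have [v _ E] := proj3_line p; rewrite E limg_mulmx mulmx1. Qed.

Lemma isometry3_comp (f g : proj3 R -> proj3 R) :
  isometry3 f -> isometry3 g -> isometry3 (g \o f).
Proof.
move=> [A [oA fA]] [B [oB gB]]; exists (A *m B); split; last exact: induced_comp.
by rewrite trmx_mul mulmxA -(mulmxA A) oB mulmx1.
Qed.

Lemma isometry3_inv (f : proj3 R -> proj3 R) : isometry3 f ->
  exists g, [/\ isometry3 g, cancel f g & cancel g f].
Proof.
move=> [A [oA fA]]; have oA' := mulmx1C oA.
have [g gA] : exists g : proj3 R -> proj3 R, induced_by A^T g.
  by apply: induced_exists; have [_] := mulmx1_unit oA.
exists g; split; first by exists A^T; rewrite trmxK.
- move=> p; have := induced_comp fA gA; rewrite oA => /induced_inj.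
  by move=> /(_ _ induced_id)/(congr1 (@^~ p)).
- move=> p; have := induced_comp gA fA; rewrite oA' => /induced_inj.
  by move=> /(_ _ induced_id)/(congr1 (@^~ p)).
Qed.

Lemma vec_dim x : \dim <[vec R x]>%VS == 1%N.
Proof. by rewrite dim_vline vec_neq0. Qed.

Definition point_of x : proj3 R := exist (fun L => is_true (\dim L == 1%N)) _ (vec_dim x).

Lemma point_ofE p x : val p = <[vec R x]>%VS -> p = point_of x.
Proof. by move=> E; apply: val_inj. Qed.

Lemma point_of_antipode x : point_of (antipode x) = point_of x.
Proof.
by apply: val_inj; rewrite /= vec_antipode vline_opp.
Qed.

Lemma point_of_eq x y : point_of x = point_of y -> x = y \/ x = antipode y.
Proof.
move=> /(congr1 val) /= E; have : vec R x \in <[vec R y]>%VS by rewrite -E memv_line.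
by move=> /vlineP [k /vec_colinear].
Qed.

Lemma flipK i : involutive (@flip^~ i).
Proof. by move=> x; apply/ffunP => j; rewrite !ffunE; case: eqP => // _; rewrite negbK. Qed.

Lemma flip_antipode x i : flip (antipode x) i = antipode (flip x i).
Proof. by apply/ffunP => j; rewrite !ffunE; case: eqP. Qed.

Lemma segment_sym v w : segment v w = segment w v.
Proof.
suff H (v1 w1 : 'rV[R]_4) : segment v1 w1 `<=` segment w1 v1 by rewrite eqEsubset; split.
move=> p [t /andP[t0 t1] E]; exists (1 - t); first by rewrite subr_ge0 t1 lerBlDr lerDl.
by rewrite E opprB addrCA subrr addr0 addrC.
Qed.

Lemma segment_opp v w : segment (- v) (- w) = segment v w.
Proof.
apply/seteqP; split=> p [t t01 E]; exists t => //.
  by rewrite E !scalerN -opprD vline_opp.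
by rewrite E !scalerN -opprD vline_opp.
Qed.

Lemma segment_image (A : 'M[R]_4) (f : proj3 R -> proj3 R) v w :
  A \in unitmx -> induced_by A f -> f @` segment v w = segment (v *m A) (w *m A).
Proof.
move=> uA fA; apply/seteqP; split=> [_ [p [t t01 E] <-]|p [t t01 E]].
  by exists t; rewrite // (induced_line fA E) mulmxDl -!scalemxAl.
have [g gA] : exists g : proj3 R -> proj3 R, induced_by (invmx A) g.
  by apply: induced_exists; rewrite unitmx_inv.
exists (g p); last first.
  have := induced_comp gA fA; rewrite mulVmx // => /induced_inj.
  by move=> /(_ _ induced_id)/(congr1 (@^~ p)).
exists t; rewrite // (induced_line gA E) mulmxDl -!scalemxAl.
by rewrite !mulmxK.
Qed.

Definition cube_edge x i : set (proj3 R) := segment (vec R x) (vec R (flip x i)).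

Lemma cube_edge_flip x i : cube_edge (flip x i) i = cube_edge x i.
Proof. by rewrite /cube_edge flipK segment_sym. Qed.

Lemma cube_edge_antipode x i : cube_edge (antipode x) i = cube_edge x i.
Proof. by rewrite /cube_edge flip_antipode !vec_antipode segment_opp. Qed.

(** Off coordinate [i] a point of the segment agrees with [x], so a sign vector on the same line
    agrees there with [x] up to a common sign. Coordinate [i] then decides between the two ends. *)
Lemma cube_edge_vertex x i y : cube_edge x i (point_of y) <->
  point_of y = point_of x \/ point_of y = point_of (flip x i).
Proof.
split=> [[t _ /= E]|].
  have /vlineP [k Ek] : vec R y \in <[(1 - t) *: vec R x + t *: vec R (flip x i)]>%VS.
    by rewrite -E memv_line.
  pose b := y i (+) x i.
  have Ej j : (-1) ^+ y j = k * (if j == i then 1 - t *+ 2 else 1) * (-1) ^+ x j :> R.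
    have /rowP/(_ j) := Ek; rewrite !mxE !ffunE => ->; rewrite -mulrA; congr (_ * _).
    case: eqP => _; first by rewrite signrN mulrN -mulrBl -addrA -opprD -mulr2n.
    by rewrite -mulrDl subrK.
  (* Any coordinate other than [i] serves to read off the common sign [k]. *)
  pose j := if i == ord0 then ord_max else ord0 : 'I_4.
  have ji : j != i by rewrite /j; case: (i =P ord0) => [->|/eqP]; rewrite 1?eq_sym.
  have Ek' : k = (-1) ^+ (y j (+) x j).
    by rewrite signr_addb Ej (negbTE ji) mulr1 -mulrA -expr2 sqrr_sign mulr1.
  have yx j' : j' != i -> y j' = y j (+) x j (+) x j'.
    move=> j'i; apply: (@signr_inj R); rewrite Ej (negbTE j'i) mulr1 Ek'.
    by rewrite [RHS]signr_addb.
  have [yi|yi] : y i = y j (+) x j (+) x i \/ y i = y j (+) x j (+) ~~ x i.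
    by case: (y i) (y j) (x j) (x i) => [] [] [] []; auto.
  - left; case E1: (y j (+) x j) in yi yx.
      rewrite -[RHS]point_of_antipode; congr point_of; apply/ffunP => j'; rewrite ffunE.
      by have [->|/yx] := eqVneq j' i.
    by congr point_of; apply/ffunP => j'; have [->|/yx] := eqVneq j' i.
  - right; case E1: (y j (+) x j) in yi yx.
      rewrite -[RHS]point_of_antipode; congr point_of; apply/ffunP => j'; rewrite !ffunE.
      by have [->|/yx] := eqVneq j' i.
    congr point_of; apply/ffunP => j'; rewrite !ffunE.
    by have [->|/yx] := eqVneq j' i.
move=> [] ->.
  by exists 0; rewrite ?lexx ?ler01 // subr0 scale1r scale0r addr0.
by exists 1; rewrite ?lexx ?ler01 // subrr scale1r scale0r add0r.
Qed.

(** Matrices act on row vectors from the right, so coordinate [j] of the image is coordinate [t j]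
    up to the sign [e j], as in [act_bits]. *)
Definition signed_perm (t : 'I_4 -> 'I_4) (e : 'I_4 -> bool) : 'M[R]_4 :=
  \matrix_(i, j) ((-1) ^+ e j * (i == t j)%:R).

Lemma vec_signed_perm t e x :
  vec R x *m signed_perm t e = vec R [ffun j => x (t j) (+) e j].
Proof.
apply/rowP => j; rewrite !mxE (bigD1 (t j)) //= !mxE eqxx mulr1 ffunE signr_addb.
by rewrite big1 ?addr0 // => i /negbTE ij; rewrite !mxE ij !mulr0.
Qed.

Lemma signed_perm_orthogonal t e :
  injective t -> signed_perm t e *m (signed_perm t e)^T = 1%:M.
Proof.
move=> t_inj; apply: mulmx1C; apply/matrixP => j k; rewrite !mxE (bigD1 (t j)) //=.
rewrite !mxE eqxx mulr1 (inj_eq t_inj) big1 ?addr0.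
  by case: (eqVneq j k) => [->|]; rewrite ?mulr0 // mulr1 -expr2 sqrr_sign.
by move=> i /negbTE ij; rewrite !mxE ij mulr0 mul0r.
Qed.

Lemma signed_perm_opp t e : - signed_perm t e = signed_perm t (fun j => ~~ e j).
Proof. by apply/matrixP => i j; rewrite !mxE signrN mulNr. Qed.

(* Halving the difference of the images of two adjacent vertices of the cube
   shows that the entries of A belong to {0, 1, -1}. *)
Lemma orthogonal_signed_perm (A : 'M[R]_4) : A *m A^T = 1%:M ->
  (forall x, exists y, <[vec R x *m A]>%VS = <[vec R y]>%VS) ->
  exists t e, injective t /\ A = signed_perm t e.
Proof.
move=> oA HA.
have normE (v : 'rV[R]_4) : (v *m A) *m (v *m A)^T = v *m v^T.
  by rewrite trmx_mul mulmxA -(mulmxA v) oA mulmx1.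
have norm_vec x : (vec R x *m (vec R x)^T) 0 0 = 4%:R.
  rewrite mxE (eq_bigr (fun=> 1)) ?sumr_const ?card_ord // => i _.
  by rewrite !mxE -expr2 sqrr_sign.
(* The hypothesis only concerns lines. As [A] preserves the norm and all sign vectors have the same
   norm, the factor is 1 or -1, and the antipode absorbs the sign. *)
have HA' x : exists y, vec R x *m A = vec R y.
  have [y E] := HA x.
  have /vlineP [k Ek] : vec R x *m A \in <[vec R y]>%VS by rewrite -E memv_line.
  have /eqP := normE (vec R x); rewrite Ek linearZ /= -scalemxAl -scalemxAr scalerA.
  move=> /eqP/matrixP/(_ 0 0); rewrite mxE !norm_vec => /eqP.
  rewrite -[X in _ == X]mul1r (inj_eq (mulIf _)) ?pnatr_eq0 // -expr2 sqrf_eq1.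
  case/orP=> /eqP ->; first by exists y; rewrite scale1r.
  by exists (antipode y); rewrite vec_antipode scaleN1r.
have entry i j : A i j = 0 \/ A i j ^+ 2 = 1.
  pose x := [ffun=> false] : signs.
  have [y Ey] := HA' x; have [z Ez] := HA' (flip x i).
  have : ((vec R x - vec R (flip x i)) *m A) 0 j = (vec R y - vec R z) 0 j.
    by rewrite mulmxBl Ey Ez.
  have -> : vec R x - vec R (flip x i) = 2%:R *: delta_mx 0 i.
    apply/rowP => k; rewrite !mxE !ffunE; case: eqP => _ /=.
      by rewrite expr0 expr1 opprK mulr1.
    by rewrite subrr mulr0.
  rewrite -scalemxAl -rowE !mxE => E.
  have {E} -> : A i j = ((-1) ^+ y j - (-1) ^+ z j) / 2%:R.
    by rewrite -E mulrC mulKf ?pnatr_eq0.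
  case: (y j) (z j) => [] []; rewrite ?subrr ?mul0r; [by left| | |by left]; right;
  by rewrite expr1 expr0 ?opprK -?opprD ?mulNr ?sqrrN -(mulr2n 1) divff ?expr1n ?pnatr_eq0.
have rowA i : \sum_j A i j ^+ 2 = 1.
  have /matrixP/(_ i i) := oA; rewrite !mxE eqxx mulr1n => <-.
  by apply: eq_bigr => j _; rewrite mxE.
have colA j : \sum_i A i j ^+ 2 = 1.
  have /matrixP/(_ j j) := mulmx1C oA; rewrite !mxE eqxx mulr1n => <-.
  by apply: eq_bigr => i _; rewrite mxE.
(* A column of norm 1 with entries in {0, 1, -1} has exactly one nonzero entry; [t j] is its row. *)
have /choice [t Ht] j : exists i, A i j ^+ 2 = 1.
  apply/not_existsP => H; have := colA j; rewrite big1 => [/eqP|i _].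
    by rewrite eq_sym oner_eq0.
  by case: (entry i j) => [->|/H //]; rewrite expr0n.
have other j i : i != t j -> A i j = 0.
  move=> ij; have := colA j; rewrite (bigD1 (t j)) //= Ht => /eqP.
  rewrite -[X in _ == X]addr0 (inj_eq (addrI _)) psumr_eq0 => [|k _]; last exact: sqr_ge0.
  by move=> /allP/(_ i); rewrite mem_index_enum ij sqrf_eq0 => /(_ isT)/eqP.
exists t, (fun j => A (t j) j < 0); split.
  (* Two columns sharing the row [t j] would give this row a squared norm of at least 2. *)
  move=> j k tjk; apply/eqP/negPn/negP => jk.
  have := rowA (t j); rewrite (bigD1 j) //= Ht (bigD1 k) 1?eq_sym //= {1}tjk Ht => /eqP.
  rewrite -[X in _ == X]addr0 (inj_eq (addrI _)) gt_eqF // ltr_pwDl ?ltr01 //.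
  by apply: sumr_ge0 => l _; exact: sqr_ge0.
apply/matrixP => i j; rewrite !mxE; have [->|/other ->] := eqVneq i (t j); last by rewrite mulr0.
have /eqP := Ht j; rewrite sqrf_eq1 mulr1 => /orP[]/eqP ->.
  by rewrite ltr10.
by rewrite oppr_lt0 ltr01 expr1.
Qed.

End Geometry.

Local Open Scope classical_set_scope.

(** * Flags of a graded poset of subgraphs *)

Lemma gradedP (T : eqType) (le : rel T) rs i j G H :
  graded le rs -> i < size rs -> j < size rs ->
  G \in nth [::] rs i -> H \in nth [::] rs j -> le G H ->
  (i < j \/ i = j /\ G = H) /\
  (forall k, i < k < j -> exists2 K, K \in nth [::] rs k & le G K && le K H).
Proof.
move=> /and3P[_ _ /allP gr] irs jrs Gi Hj GH.
have {}gr := gr i; rewrite mem_iota irs in gr; have /allP/(_ j) := gr isT.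
rewrite mem_iota jrs => /(_ isT)/allP/(_ _ Gi)/allP/(_ _ Hj).
rewrite GH => /andP[ij /allP kP]; split.
  by case/orP: ij => [|/andP[/eqP ? /eqP]]; [left|right].
move=> k /andP[ik kj]; apply/hasP/kP.
by rewrite mem_iota ik subnKC // (ltn_trans ik).
Qed.

Lemma seq_max (T : eqType) (le : rel T) (s : seq T) : reflexive le -> transitive le ->
  s != [::] -> {in s &, total le} -> exists2 a, a \in s & {in s, forall b, le b a}.
Proof.
move=> le_refl le_trans; elim: s => [//|a [|b s] IH] _ tot.
  by exists a; rewrite ?mem_head // => c; rewrite inE => /eqP ->.
have [|m ms mP] := IH isT.
  by move=> x y xs ys; apply: tot; rewrite inE ?xs ?ys orbT.
have ms' : m \in [:: a, b & s] by rewrite inE ms orbT.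
have /orP[am|ma] := tot a m (mem_head _ _) ms'.
  by exists m => // c; rewrite inE => /predU1P[->|/mP].
exists a; first exact: mem_head.
by move=> c; rewrite inE => /predU1P[->|/mP cm]; last exact: le_trans ma.
Qed.

Lemma mem_flatten_nth (T : eqType) (rs : seq (seq T)) G :
  reflect (exists2 k, k < size rs & G \in nth [::] rs k) (G \in flatten rs).
Proof.
apply: (iffP flattenP) => [[r rrs Gr]|[k krs Gk]].
  by exists (index r rs); rewrite ?index_mem ?nth_index.
by exists (nth [::] rs k) => //; exact: mem_nth.
Qed.

Lemma all2_mem_nth (T : eqType) (rs : seq (seq T)) x0 s :
  all2 (fun (H : T) (r : seq T) => H \in r) s rs ->
  size s = size rs /\ forall k, k < size rs -> nth x0 s k \in nth [::] rs k.
Proof.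
elim: rs s => [|r rs IH] [|H s] //= /andP[Hr /IH[-> nthP]]; split=> //.
by case=> [|k] //= /nthP.
Qed.

Lemma nth_all2_mem (T : eqType) (rs : seq (seq T)) x0 s :
  size s = size rs -> (forall k, k < size rs -> nth x0 s k \in nth [::] rs k) ->
  all2 (fun (H : T) (r : seq T) => H \in r) s rs.
Proof.
elim: rs s => [|r rs IH] [|H s] //= [ss] nthP; rewrite (nthP 0%N) //= IH // => k krs.
exact: (nthP k.+1).
Qed.

Section Flags.
Variables (R : realType) (T : eqType) (le : rel T) (real : T -> subgraph R).
Variables (rs : seq (seq T)) (P : int -> set (subgraph R)).
Hypotheses (le_refl : reflexive le) (le_trans : transitive le).
Hypothesis (real_le : {in flatten rs &, forall G H,
  subgraph_le (real G) (real H) <-> le G H}).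
Hypothesis (all_facesE : all_faces P = real @` [set` flatten rs]).
Hypothesis (rs_graded : graded le rs).

Definition realize (s : seq T) : set (subgraph R) := real @` [set` s].

Let mem_rank k G : k < size rs -> G \in nth [::] rs k -> G \in flatten rs.
Proof. by move=> krs Gk; apply/mem_flatten_nth; exists k. Qed.

Lemma flag_comparable C X : flag P C -> all_faces P X ->
  (forall Y, C Y -> subgraph_le X Y \/ subgraph_le Y X) -> C X.
Proof.
move=> [[CP Ctot] Cmax] PX XC.
have <- : C `|` [set X] = C; last by right.
apply: Cmax; last by left.
split=> [Y [/CP //|-> //]|Y Z [CY|->] [CZ|->]]; first exact: Ctot.
- by have [] := XC _ CY; auto.
- exact: XC.
- by left; split.
Qed.

(* A flag that avoids rank k could be refined between its last face below and
   its first face above this rank. *)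
Lemma flag_rank C k : flag P C -> k < size rs ->
  exists2 G, G \in nth [::] rs k & C (real G).
Proof.
move=> fC krs; have [[CP Ctot] _] := fC; apply: contrapT => noG.
have C_face X : C X -> exists j G, [/\ j < size rs, G \in nth [::] rs j & X = real G].
  by move=> /CP; rewrite all_facesE => -[G /mem_flatten_nth[j jrs Gj] <-]; exists j, G.
have add_face G : G \in nth [::] rs k ->
    (forall H, H \in flatten rs -> C (real H) -> le G H \/ le H G) -> False.
  move=> Gk GP; apply: noG; exists G => //; apply: (flag_comparable fC).
    by rewrite all_facesE; exists G => //; exact: mem_rank Gk.
  move=> X /[dup] CX /C_face[j [H [jrs Hj XE]]]; have Hrs := mem_rank jrs Hj.
  by subst X; rewrite !real_le ?(mem_rank krs Gk) //; exact: GP.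
have rs0 : 0 < size rs by exact: leq_ltn_trans krs.
have [k0|k_gt0] := posnP k.
  have /and3P[/hasP[B B0 /allP Bmin] _ _] := rs_graded.
  by apply: (@add_face B); rewrite ?k0 // => H /Bmin; left.
have [kl|k_lt] : k = (size rs).-1 \/ k < (size rs).-1.
- by apply/predU1P; rewrite -leq_eqVlt -ltnS prednK.
  have /and3P[_ /hasP[B B1 /allP Bmax] _] := rs_graded.
  by apply: (@add_face B); rewrite ?kl // => H /Bmax; right.
have l_rs : (size rs).-1 < size rs by rewrite prednK.
(* The faces of [C] with ranks in [js], as a list, so that extremal elements exist; membership in
   [C] is decided classically. *)
pose part (js : seq nat) :=
  [seq G <- flatten [seq nth [::] rs j | j <- js] | `[< C (real G) >]].
have partP js G : {subset js <= iota 0 (size rs)} ->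
    reflect (exists j, [/\ j \in js, j < size rs, G \in nth [::] rs j & C (real G)])
      (G \in part js).
  move=> jsrs; rewrite mem_filter; apply: (iffP andP).
    move=> [/asboolP CG /flatten_mapP[j jjs Gj]]; exists j; split=> //.
    by have := jsrs _ jjs; rewrite mem_iota.
  move=> [j [jjs _ Gj CG]]; split; first exact/asboolP.
  by apply/flatten_mapP; exists j.
have part_tot js : {subset js <= iota 0 (size rs)} -> {in part js &, total le}.
  move=> jsrs G H /(partP _ _ jsrs)[j [_ jrs Gj CG]] /(partP _ _ jsrs)[i [_ irs Hi CH]].
  have := Ctot _ _ CG CH.
  rewrite !real_le ?(mem_rank jrs Gj) ?(mem_rank irs Hi) //.
  by move=> [->|->]; rewrite ?orbT.
have low_rs : {subset iota 0 k <= iota 0 (size rs)}.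
  by move=> j; rewrite !mem_iota => /= /ltn_trans; apply.
have high_rs : {subset iota k.+1 (size rs - k.+1) <= iota 0 (size rs)}.
  by move=> j; rewrite !mem_iota /= subnKC // => /andP[].
have bot_low : part (iota 0 k) != [::].
  have /and3P[/hasP[B B0 /allP Bmin] _ _] := rs_graded.
  suff : B \in part (iota 0 k) by case: (part _).
  apply/partP => //; exists 0; rewrite mem_iota k_gt0; split=> //.
  apply: (flag_comparable fC).
    by rewrite all_facesE; exists B => //; exact: mem_rank B0.
  move=> X /C_face[j [H [jrs Hj ->]]]; left.
  by apply/real_le; rewrite ?(mem_rank rs0 B0) ?Bmin ?(mem_rank jrs Hj).
have top_high : part (iota k.+1 (size rs - k.+1)) != [::].
  have /and3P[_ /hasP[B B0 /allP Bmax] _] := rs_graded.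
  suff : B \in part (iota k.+1 (size rs - k.+1)) by case: (part _).
  apply/partP => //; exists (size rs).-1; split=> //.
    by rewrite mem_iota k_lt subnKC.
  apply: (flag_comparable fC).
    by rewrite all_facesE; exists B => //; exact: mem_rank B0.
  move=> X /C_face[j [H [jrs Hj ->]]]; right.
  by apply/real_le; rewrite ?(mem_rank l_rs B0) ?Bmax ?(mem_rank jrs Hj).
have [a /partP -/(_ low_rs)[i [ik irs ai Ca]] amax] :=
  seq_max le_refl le_trans bot_low (part_tot _ low_rs).
have ge_trans : transitive (fun x y => le y x) by move=> x y z yx zy; exact: le_trans yx.
have [|b /partP -/(_ high_rs)[j [jk jrs bj Cb]] bmin] :=
  @seq_max _ (fun x y => le y x) _ le_refl ge_trans top_high.
  by move=> x y xs ys; rewrite orbC; exact: part_tot xs ys.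
move: ik jk; rewrite !mem_iota /= subnKC // => ik /andP[kj _].
(* Ranks increase along the order, so [b], whose rank exceeds [k], cannot lie below [a]. *)
have ab : le a b.
  have := Ctot _ _ Ca Cb; rewrite !real_le ?(mem_rank irs ai) ?(mem_rank jrs bj) //.
  move=> [//|ba]; have [[ji|[ji _]] _] := gradedP rs_graded jrs irs bj ai ba.
    by have := ltn_trans (ltn_trans ik kj) ji; rewrite ltnn.
  by have := ltn_trans ik kj; rewrite ji ltnn.
(* A face [K] of rank [k] between [a] and [b] is comparable with all of [C]: the faces of [C] of
   lower rank are below [a], and those of higher rank are above [b]. *)
have [_ /(_ k)] := gradedP rs_graded irs jrs ai bj ab.
rewrite ik kj => /(_ isT)[K Kk /andP[aK Kb]]; apply: (add_face K Kk).
move=> H /mem_flatten_nth[l lrs Hl] CH; have [lk|kl|lk] := ltngtP l k.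
- right; apply: le_trans aK; apply: amax; apply/partP => //; exists l.
  by rewrite mem_iota lk.
- left; apply: (le_trans Kb); apply: bmin; apply/partP => //; exists l.
  by rewrite mem_iota kl subnKC.
- by case: noG; exists H; rewrite // -lk.
Qed.

Lemma same_rank_eq k G H : k < size rs -> G \in nth [::] rs k -> H \in nth [::] rs k ->
  le G H \/ le H G -> G = H.
Proof.
move=> krs Gk Hk [GH|HG].
  by have [[|[]] //] := gradedP rs_graded krs krs Gk Hk GH; rewrite ltnn.
by have [[|[]] //] := gradedP rs_graded krs krs Hk Gk HG; rewrite ltnn.
Qed.

(** Choosing a face of [C] in each rank lists the whole flag, since comparable faces of equal rank
    coincide. For the same reason an increasing list with one face per rank cannot be enlarged as a
    chain. *)
Lemma flagP C : flag P C <-> exists2 s, s \in flags le rs & C = realize s.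
Proof.
split=> [fC|[s sP ->]].
  have [[CP Ctot] _] := fC.
  have /choice[g gP] k : exists G, k < size rs -> G \in nth [::] rs k /\ C (real G).
    have [krs|] := boolP (k < size rs).
      by have [G] := flag_rank fC krs; exists G.
    have [G _ _] : exists2 G, G \in nth [::] rs 0 & all (le G) (flatten rs).
      by have /and3P[/hasP] := rs_graded.
    by exists G.
  have gC k : k < size rs -> C (real (g k)) by move=> /gP[].
  have g_rank k : k < size rs -> g k \in nth [::] rs k by move=> /gP[].
  exists (mkseq g (size rs)).
    rewrite mem_flags; apply/andP; split.
      apply/(sortedP (g 0)) => i; rewrite size_mkseq => irs.
      have irs' := ltnW irs; rewrite !nth_mkseq //.
      have := Ctot _ _ (gC i irs') (gC _ irs).
      rewrite !real_le ?(mem_rank irs (g_rank _ irs)) ?(mem_rank irs' (g_rank _ irs')) //.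
      move=> [//|gle].
      have [[lt|[/eqP eq _]] _] := gradedP rs_graded irs irs' (g_rank _ irs) (g_rank _ irs') gle.
        by rewrite ltnNge leqnSn in lt.
      by rewrite eqn_leq ltnn in eq.
    apply: (@nth_all2_mem T rs (g 0)) => [|k krs]; first by rewrite size_mkseq.
    by rewrite nth_mkseq ?g_rank.
  apply/seteqP; split=> [X /[dup] CX /CP|_ [G /mapP[k] + -> <-]]; last first.
    by rewrite mem_iota => /gC.
  rewrite all_facesE => -[H /mem_flatten_nth[k krs Hk] XH]; subst X.
  exists H => //=; apply/mapP; exists k; rewrite ?mem_iota //.
  apply: (same_rank_eq krs Hk (g_rank _ krs)).
  have := Ctot _ _ CX (gC _ krs).
  by rewrite !real_le ?(mem_rank krs Hk) ?(mem_rank krs (g_rank _ krs)).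
move: sP; rewrite mem_flags => /andP[s_sorted s_ranks].
have s_rs : {subset s <= flatten rs}.
  move=> G Gs; have [ss nthP] := all2_mem_nth G s_ranks.
  have krs : index G s < size rs by rewrite -ss index_mem.
  by apply: (mem_rank krs); have := nthP _ krs; rewrite nth_index.
have s_tot : {in s &, total le}.
  move=> G H Gs Hs; wlog GH : G H Gs Hs / index G s <= index H s.
    by have [|/ltnW] := leqP (index G s) (index H s) => ? /(_ _ _) W; [|rewrite orbC]; exact: W.
  apply/orP; left; rewrite -(nth_index G Gs) -(nth_index G Hs).
  by apply: (sorted_leq_nth le_trans le_refl); rewrite ?inE ?index_mem.
split.
  split=> [_ [G Gs <-]|_ _ [G Gs <-] [H Hs <-]].
    by rewrite all_facesE; exists G => //; exact: s_rs.
  by rewrite !real_le ?s_rs //; apply/orP; exact: s_tot.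
move=> D [DP Dtot] sD; apply/seteqP; split=> // X /[dup] DX /DP.
rewrite all_facesE => -[H /mem_flatten_nth[k krs Hk] XH]; subst X.
have [ss nthP] := all2_mem_nth H s_ranks; have Gk := nthP _ krs.
have Gs : nth H s k \in s by rewrite mem_nth ?ss.
exists H => //=; have -> // : H = nth H s k.
apply: (same_rank_eq krs Hk Gk).
have DG : D (real (nth H s k)) by apply: sD; exists (nth H s k).
have := Dtot _ _ DX DG.
by rewrite !real_le ?(mem_rank krs Hk) ?s_rs.
Qed.

End Flags.

(** * Realization of the finite model *)

Definition signs_of (x : seq bool) : signs := [ffun i : 'I_4 => nth false x i].

Lemma bits_size x : (x \in bits) = (size x == 4).
Proof.
rewrite mem_words andb_idr // => _; apply/allP => b _; by case: b.
Qed.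

Lemma mem_bflip x i : bflip x i \in bits.
Proof. by rewrite bits_size size_mkseq. Qed.

Lemma mem_act_bits g x : act_bits g x \in bits.
Proof. by rewrite bits_size size_mkseq. Qed.

Lemma bvertices_bits v : v \in bvertices -> v \in bits.
Proof. by rewrite mem_filter => /andP[]. Qed.

Lemma mem_bnorm x : x \in bits -> bnorm x \in bvertices.
Proof. by apply/allP: x; vm_compute. Qed.

Lemma mem_bedge x i : x \in bits -> i < 4 -> bedge x i \in bedges.
Proof.
move=> xb i4; have i4' : i \in iota 0 4 by rewrite mem_iota.
have : all (fun i => all (fun x => bedge x i \in bedges) bits) (iota 0 4) by vm_compute.
by move=> /allP/(_ _ i4')/allP/(_ _ xb).
Qed.

Lemma bedges_dir e : e \in bedges -> e.2 < 4.
Proof. by apply/allP: e; vm_compute. Qed.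

Lemma bedges_bits e : e \in bedges -> e.1 \in bits.
Proof. by apply/allP: e; vm_compute. Qed.

Lemma ends_bvertices e v : e \in bedges -> v \in ends e -> v \in bvertices.
Proof.
have : all (fun e => all [in bvertices] (ends e)) bedges by vm_compute.
by move=> /allP H /H/allP; apply.
Qed.

Lemma ends_inj e e' : e \in bedges -> e' \in bedges ->
  {in bvertices, ends e =i ends e'} -> e = e'.
Proof.
have : all (fun e => all (fun e' =>
    all (fun v => (v \in ends e) == (v \in ends e')) bvertices ==> (e == e')) bedges) bedges.
  by vm_compute.
move=> /allP H /H/allP{}H /H/implyP{}H E; apply/eqP/H/allP => v vb.
by rewrite E.
Qed.

Lemma signs_of_surj (x : signs) : exists2 b, b \in bits & signs_of b = x.
Proof.
exists (mkseq (fun k => x (inord k)) 4); first by rewrite bits_size size_mkseq.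
by apply/ffunP => i; rewrite ffunE nth_mkseq // inord_val.
Qed.

Lemma signs_of_inj : {in bits &, injective signs_of}.
Proof.
move=> x y; rewrite !bits_size => /eqP sx /eqP sy /ffunP E.
apply: (@eq_from_nth _ false); rewrite sx ?sy // => i i4.
by have := E (Ordinal i4); rewrite !ffunE.
Qed.

Lemma signs_of_bflip x i : i < 4 -> signs_of (bflip x i) = flip (signs_of x) (inord i).
Proof.
move=> i4; apply/ffunP => j; rewrite !ffunE nth_mkseq // -val_eqE /= inordK //.
by case: eqP => _; rewrite ?addbT ?addbF.
Qed.

Lemma signs_of_negb x : x \in bits -> signs_of (map negb x) = antipode (signs_of x).
Proof.
rewrite bits_size => /eqP sx; apply/ffunP => j.
by rewrite !ffunE (nth_map false) // sx.
Qed.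

Section Realization.
Variable R : realType.

Definition vertex_point (x : seq bool) : proj3 R := point_of R (signs_of x).
Definition edge_segment (e : seq bool * nat) : set (proj3 R) :=
  cube_edge (R := R) (signs_of e.1) (inord e.2).
Definition realize_face (G : face) : subgraph R :=
  Subgraph (vertex_point @` [set` G.1]) (edge_segment @` [set` G.2]).

Lemma vertex_point_bnorm x : x \in bits -> vertex_point (bnorm x) = vertex_point x.
Proof.
move=> xb; rewrite /vertex_point /bnorm; case: ifP => // _.
by rewrite signs_of_negb // point_of_antipode.
Qed.

Lemma vertex_point_inj : {in bvertices &, injective vertex_point}.
Proof.
move=> v w vb wb /point_of_eq[/signs_of_inj E|]; first by apply: E; exact: bvertices_bits.
have sw : size w = 4 by apply/eqP; rewrite -bits_size bvertices_bits.
rewrite -signs_of_negb ?bvertices_bits // => /signs_of_inj E.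
have {}E : v = map negb w.
  by apply: E; rewrite ?bits_size ?size_map ?sw // -bits_size bvertices_bits.
move: vb wb; rewrite !mem_filter E (nth_map false) ?sw // negbK.
by move=> /andP[-> _].
Qed.

Lemma edge_segment_bedge x i : x \in bits -> i < 4 ->
  edge_segment (bedge x i) = cube_edge (R := R) (signs_of x) (inord i).
Proof.
have edge_bnorm y : y \in bits ->
    cube_edge (R := R) (signs_of (bnorm y)) (inord i) =
    cube_edge (R := R) (signs_of y) (inord i).
  by move=> yb; rewrite /bnorm; case: ifP => // _; rewrite signs_of_negb // cube_edge_antipode.
move=> xb i4; rewrite /edge_segment /= edge_bnorm; last by case: ifP; rewrite ?mem_bflip.
by case: ifP => // _; rewrite signs_of_bflip // cube_edge_flip.
Qed.

Lemma edge_segment_ends v e : v \in bvertices -> e \in bedges ->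
  edge_segment e (vertex_point v) <-> v \in ends e.
Proof.
move=> vb eb; have eb1 := bedges_bits eb; have e4 := bedges_dir eb.
have -> : (v \in ends e) = (v == e.1) || (v == bnorm (bflip e.1 e.2)).
  by rewrite !inE.
have e1b : e.1 \in bvertices by apply: (ends_bvertices eb); rewrite mem_head.
rewrite /edge_segment /vertex_point cube_edge_vertex -signs_of_bflip //.
rewrite -/(vertex_point v) -/(vertex_point e.1) -/(vertex_point (bflip _ _)).
rewrite -(vertex_point_bnorm (mem_bflip e.1 e.2)).
have bfb := mem_bnorm (mem_bflip e.1 e.2).
split=> [[]/vertex_point_inj E|/orP[]/eqP ->]; [|  |by left|by right].
  by rewrite E ?eqxx.
by rewrite E ?eqxx ?orbT.
Qed.

(** A segment is determined by the vertices of Gamma that it contains, because Gamma has no multiple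
    edges. *)
Lemma edge_segment_inj : {in bedges &, injective edge_segment}.
Proof.
move=> e e' eb eb' E; apply: ends_inj => // v vb.
apply/idP/idP; first by move=> /(edge_segment_ends vb eb); rewrite E => /(edge_segment_ends vb eb').
by move=> /(edge_segment_ends vb eb'); rewrite -E => /(edge_segment_ends vb eb).
Qed.

Lemma gamma_vertexE : @gamma_vertex R = vertex_point @` [set` bvertices].
Proof.
apply/seteqP; split=> [p [x /point_ofE ->]|_ [v _ <-]]; last by exists (signs_of v).
have [b bb <-] := signs_of_surj x; exists (bnorm b); first exact: mem_bnorm.
exact: vertex_point_bnorm.
Qed.

Lemma edge_in_directionP (i : 'I_4) E :
  edge_in_direction i E <-> exists e, [/\ e \in bedges, e.2 = i & edge_segment e = E].
Proof.
split=> [[x ->]|[e [eb ei <-]]]; last by exists (signs_of e.1); rewrite /edge_segment ei inord_val.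
have [b bb <-] := signs_of_surj x; exists (bedge b i).
by rewrite mem_bedge ?edge_segment_bedge ?inord_val.
Qed.

Lemma gamma_edgeE : @gamma_edge R = edge_segment @` [set` bedges].
Proof.
apply/seteqP; split=> [E [i /edge_in_directionP[e [eb _ <-]]]|_ [e eb <-]].
  by exists e.
exists (Ordinal (bedges_dir eb)); apply/edge_in_directionP; exists e; split=> //.
Qed.

Lemma valid_canon W D : valid (canon W D).
Proof.
by apply/eqP; congr pair; apply: eq_in_filter => z zb; rewrite [RHS]mem_filter zb andbT.
Qed.

Lemma valid_vertices G v : valid G -> v \in G.1 -> v \in bvertices.
Proof. by move=> /eqP ->; rewrite mem_filter => /andP[]. Qed.

Lemma valid_edges G e : valid G -> e \in G.2 -> e \in bedges.
Proof. by move=> /eqP ->; rewrite mem_filter => /andP[]. Qed.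

Lemma realize_face_vertex G v : valid G -> v \in bvertices ->
  vertices (realize_face G) (vertex_point v) <-> v \in G.1.
Proof.
move=> vG vb; split=> [[w wG /vertex_point_inj <- //]|vG1]; last by exists v.
exact: valid_vertices wG.
Qed.

Lemma realize_face_edge G e : valid G -> e \in bedges ->
  edges (realize_face G) (edge_segment e) <-> e \in G.2.
Proof.
move=> vG eb; split=> [[e' eG /edge_segment_inj <- //]|eG1]; last by exists e.
exact: valid_edges eG.
Qed.

Lemma realize_face_le G H : valid G -> valid H ->
  subgraph_le (realize_face G) (realize_face H) <-> face_le G H.
Proof.
move=> vG vH; split=> [[sv se]|/andP[/allP sv /allP se]].
  apply/andP; split; apply/allP => z zG.
    have zb := valid_vertices vG zG.
    by apply/(realize_face_vertex vH zb)/sv/(realize_face_vertex vG zb).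
  have zb := valid_edges vG zG.
  by apply/(realize_face_edge vH zb)/se/(realize_face_edge vG zb).
by split=> _ [z zG <-]; exists z; rewrite //; [exact: sv|exact: se].
Qed.

Lemma realize_face_inj G H : valid G -> valid H -> realize_face G = realize_face H -> G = H.
Proof.
move=> vG vH E; rewrite (eqP vG) (eqP vH); congr pair; apply: eq_in_filter => z zb /=.
  apply/idP/idP; first by move=> /(realize_face_vertex vG zb); rewrite E => /(realize_face_vertex vH zb).
  by move=> /(realize_face_vertex vH zb); rewrite -E => /(realize_face_vertex vG zb).
apply/idP/idP; first by move=> /(realize_face_edge vG zb); rewrite E => /(realize_face_edge vH zb).
by move=> /(realize_face_edge vH zb); rewrite -E => /(realize_face_edge vG zb).
Qed.

Lemma realize_face_canon W D : realize_face (canon W D) =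
  Subgraph [set p | exists v, [/\ v \in bvertices, W v & vertex_point v = p]]
           [set E | exists e, [/\ e \in bedges, D e & edge_segment e = E]].
Proof.
congr Subgraph; apply/seteqP; split.
- move=> _ [v vW <-]; exists v; split=> //;
  by have /andP[] : W v && (v \in bvertices) by rewrite -mem_filter.
- by move=> _ [v [vb Wv <-]]; exists v => //; apply: etrans (mem_filter _ _ _) _; rewrite Wv.
- move=> _ [e eD <-]; exists e; split=> //;
  by have /andP[] : D e && (e \in bedges) by rewrite -mem_filter.
- by move=> _ [e [eb De <-]]; exists e => //; apply: etrans (mem_filter _ _ _) _; rewrite De.
Qed.

Lemma signed_permsP g : g \in signed_perms ->
  [/\ size g.1 = 4, uniq g.1, forall j, j < 4 -> nth 0 g.1 j < 4,
      forall i, i < 4 -> index i g.1 < 4 & g.2 \in bvertices].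
Proof.
case: g => t e /allpairsP[[t' e'] /= [t'P e'b [-> ->]]].
move: t'P; rewrite mem_filter mem_words => /and3P[ut /eqP st /allP t4].
have perm_t : perm_eq t' (iota 0 4).
  by apply: uniq_perm => //; have [|] := uniq_min_size (s2 := iota 0 4) ut t4; rewrite ?st.
split=> // [j j4|i i4].
  by have := t4 (nth 0 t' j); rewrite mem_nth ?st // mem_iota => /(_ isT).
by rewrite -[X in _ < X]st index_mem (perm_mem perm_t) mem_iota.
Qed.

Definition acts (f : proj3 R -> proj3 R) (g : seq nat * seq bool) : Prop :=
  (forall x, x \in bits -> f (vertex_point x) = vertex_point (act_bits g x)) /\
  forall e, e \in bedges -> f @` edge_segment e = edge_segment (act_edge g e).

Definition bmatrix (g : seq nat * seq bool) : 'M[R]_4 :=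
  signed_perm R (fun j => inord (nth 0 g.1 j)) (fun j => nth false g.2 j).

Lemma bmatrix_orthogonal g : g \in signed_perms -> (bmatrix g *m (bmatrix g)^T = 1%:M)%R.
Proof.
move=> /signed_permsP[sg1 ug g4 _ _]; apply: signed_perm_orthogonal => i j.
move=> /(congr1 val); rewrite /= !inordK ?g4 // => /eqP.
by rewrite nth_uniq ?sg1 // => /eqP/val_inj.
Qed.

Lemma bmatrix_acts g f : g \in signed_perms -> induced_by (bmatrix g) f -> acts f g.
Proof.
move=> gP fg; have [sg1 ug g4 gi4 _] := signed_permsP gP.
have vecg x : (vec R (signs_of x) *m bmatrix g)%R = vec R (signs_of (act_bits g x)).
  rewrite vec_signed_perm; congr vec; apply/ffunP => j.
  by rewrite !ffunE nth_mkseq // inordK ?g4.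
split=> [x xb|e eb]; first by apply: point_ofE; rewrite -vecg; exact: induced_line fg _.
have [e4 eb1] := (bedges_dir eb, bedges_bits eb).
rewrite /act_edge edge_segment_bedge ?mem_act_bits ?gi4 //.
rewrite /edge_segment /cube_edge (segment_image _ _ _ fg); last first.
  by have [] := mulmx1_unit (bmatrix_orthogonal gP).
rewrite -signs_of_bflip // !vecg; congr (segment _ (vec _ _)); apply/ffunP => j.
rewrite !ffunE !nth_mkseq ?g4 // addbAC; set t := index _ _.
have -> : (nth 0 g.1 j == e.2) = (j == inord t).
  rewrite -val_eqE /= inordK ?gi4 // -[in LHS](nth_index 0 (x := e.2) (s := g.1)).
    by rewrite nth_uniq ?sg1 ?gi4.
  by rewrite -index_mem sg1 gi4.
by case: eqP; rewrite ?addbT ?addbF.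
Qed.

Lemma acts_exists g : g \in signed_perms -> exists2 f, isometry3 f & acts f g.
Proof.
move=> gP; have oA := bmatrix_orthogonal gP.
have [f fA] : exists f : proj3 R -> proj3 R, induced_by (bmatrix g) f.
  by apply: induced_exists; have [] := mulmx1_unit oA.
by exists f; [exists (bmatrix g)|exact: bmatrix_acts].
Qed.

(** A matrix and its opposite induce the same map, so the sign at the last coordinate can be made
    positive, as the codes in [signed_perms] require. *)
Lemma isometry_acts (f : proj3 R -> proj3 R) : isometry3 f ->
  (forall x, exists y, f (point_of R x) = point_of R y) -> exists2 g, g \in signed_perms & acts f g.
Proof.
move=> [A [oA fA]] fpt.
have [|t [e [t_inj Ae]]] := orthogonal_signed_perm oA.
  move=> x; have [y /(congr1 val) E] := fpt x; exists y.
  by rewrite -(induced_line fA (erefl (val (point_of R x)))) E.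
have codeP (t' : 'I_4 -> 'I_4) e' : injective t' -> e' ord_max = false ->
    induced_by (signed_perm R t' e') f -> exists2 g, g \in signed_perms & acts f g.
  move=> t'_inj e'0 fA'.
  pose g := (mkseq (fun j => t' (inord j) : nat) 4, mkseq (fun j => e' (inord j)) 4).
  have gP : g \in signed_perms.
    apply/allpairsP; exists g; split; last by case: (g).
      rewrite mem_filter mem_words size_mkseq eqxx; apply/andP; split.
        rewrite map_inj_in_uniq ?iota_uniq // => i j; rewrite !mem_iota /= => i4 j4.
        by move=> /val_inj/t'_inj/(congr1 val); rewrite /= !inordK.
      by apply/allP => _ /mapP[j _ ->]; rewrite mem_iota /=.
    rewrite mem_filter bits_size size_mkseq nth_mkseq // andbT.
    by rewrite (_ : inord 3 = ord_max) ?e'0 //; apply: val_inj; rewrite /= inordK.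
  exists g => //; apply: bmatrix_acts => //; congr induced_by: fA'.
  by apply/matrixP => i j; rewrite !mxE !nth_mkseq // !inord_val.
case e0: (e ord_max); last by apply: (codeP t e); rewrite // -Ae.
apply: (codeP t (fun j => ~~ e j)) => //; first by rewrite e0.
by rewrite -signed_perm_opp -Ae; exact: induced_opp.
Qed.

Lemma act_face_valid g G : valid (act_face g G).
Proof. exact: valid_canon. Qed.

Lemma move_realize_face f g G : g \in signed_perms -> acts f g -> valid G ->
  move f (realize_face G) = realize_face (act_face g G).
Proof.
move=> /signed_permsP[_ _ _ gi4 _] [fv fe] vG; rewrite realize_face_canon.
congr Subgraph; apply/seteqP; split.
- move=> _ [_ [v vG1 <-] <-]; have vb := bvertices_bits (valid_vertices vG vG1).
  exists (bnorm (act_bits g v)); rewrite mem_bnorm ?mem_act_bits // vertex_point_bnorm ?mem_act_bits // fv //.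
  by split=> //; apply/mapP; exists v.
- move=> _ [_ [_ /mapP[v vG1 ->] <-]]; have vb := bvertices_bits (valid_vertices vG vG1).
  by rewrite vertex_point_bnorm ?mem_act_bits // -fv //; exists (vertex_point v) => //; exists v.
- move=> _ [_ [e eG <-] <-]; have eb := valid_edges vG eG.
  exists (act_edge g e); rewrite fe //; split=> //; last by apply/mapP; exists e.
  by rewrite mem_bedge ?mem_act_bits // gi4 ?bedges_dir.
- move=> _ [_ [_ /mapP[e eG ->] <-]]; have eb := valid_edges vG eG.
  by rewrite -fe //; exists (edge_segment e) => //; exists e.
Qed.

End Realization.

Lemma face_le_refl : reflexive face_le.
Proof. by move=> G; apply/andP; split; apply/allP. Qed.

Lemma face_le_trans : transitive face_le.
Proof.
move=> G F H /andP[/allP FG1 /allP FG2] /andP[/allP GH1 /allP GH2].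
by apply/andP; split; apply/allP => z; [move/FG1/GH1|move/FG2/GH2].
Qed.

(** * Symmetries, orbits and chirality *)

Section Moves.
Variable R : realType.
Implicit Types (f g : proj3 R -> proj3 R) (C D : set (subgraph R)).
Implicit Types (P : int -> set (subgraph R)).

Lemma move_comp f g (G : subgraph R) : move g (move f G) = move (g \o f) G.
Proof.
rewrite /move /= image_comp; congr Subgraph; rewrite image_comp.
by apply: eq_imagel => e _ /=; rewrite image_comp.
Qed.

Lemma move_id (G : subgraph R) : move id G = G.
Proof.
case: G => V E; rewrite /move /= image_id; congr Subgraph.
by rewrite (eq_imagel (f' := id)) ?image_id // => e _; rewrite image_id.
Qed.

Lemma move_cancel f g : cancel f g -> cancel (move f) (move g).
Proof.
by move=> fK G; rewrite move_comp (_ : g \o f = id) ?move_id //; apply: funext.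
Qed.

Lemma symmetry_comp P f g : symmetry P f -> symmetry P g -> symmetry P (g \o f).
Proof.
move=> [isf Pf] [isg Pg]; split; first exact: isometry3_comp.
move=> r; rewrite -[RHS]Pg -[in RHS]Pf image_comp.
by apply: eq_imagel => G _ /=; rewrite move_comp.
Qed.

Lemma symmetry_inv P f : symmetry P f ->
  exists g, [/\ symmetry P g, cancel (move f) (move g) & cancel (move g) (move f)].
Proof.
move=> [isf Pf]; have [g [isg fK gK]] := isometry3_inv isf; exists g; split.
- split=> // r; rewrite -[in LHS]Pf image_comp -[RHS]image_id.
  by apply: eq_imagel => G _ /=; rewrite move_cancel.
- exact: move_cancel.
- exact: move_cancel.
Qed.

Lemma orbit_move P f C : symmetry P f -> Defs.orbit P (move f @` C) = Defs.orbit P C.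
Proof.
move=> sf; have [g [signs_of fK gK]] := symmetry_inv sf.
apply/seteqP; split=> _ [h sh <-].
  exists (h \o f); first exact: symmetry_comp.
  by rewrite image_comp; apply: eq_imagel => G _; rewrite /= move_comp.
exists (h \o g); first exact: symmetry_comp.
rewrite image_comp; apply: eq_imagel => G _.
by rewrite /= -move_comp fK.
Qed.

Lemma orbit_refl P C : Defs.orbit P C C.
Proof.
exists id; last by rewrite (eq_imagel (f' := id)) ?image_id // => G _; rewrite move_id.
split; last first.
  by move=> r; rewrite (eq_imagel (f' := id)) ?image_id // => G _; rewrite move_id.
by exists 1%:M%R; split; [rewrite trmx1 mulmx1|exact: induced_id].
Qed.

Lemma adjacent_flags_move f C D : injective (move f) ->
  adjacent_flags C D -> adjacent_flags (move f @` C) (move f @` D).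
Proof.
have image_setD A B : injective (move f) ->
    move f @` A `\` move f @` B = move f @` (A `\` B).
  move=> f_inj; apply/seteqP; split=> [_ [[F AF <-] NB]|_ [F [AF NB] <-]].
    by exists F => //; split=> // BF; apply: NB; exists F.
  by split; [exists F|move=> [H BH /f_inj HF]; apply: NB; rewrite -HF].
move=> f_inj [F [G [CD DC]]]; exists (move f F), (move f G).
by rewrite !image_setD // CD DC !image_set1.
Qed.

End Moves.

Definition rank_faces (rs : seq (seq face)) (r : int) : seq face :=
  match r with
  | Negz 0 => nth [::] rs 0
  | Posz k => nth [::] rs k.+1
  | _ => [::]
  end.

(** * From the finite certificate to geometric chirality *)

Section Chirality.
Variables (R : realType) (P : int -> set (subgraph R)).
Variables (rs : seq (seq face)) (C1 C2 : seq face).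
Hypothesis PE : forall r, P r = (@realize_face R) @` [set` rank_faces rs r].
Hypothesis cert : chirality_certificate rs C1 C2.

Let gs := [seq g <- signed_perms | preserves g rs].

Lemma ranked_all_faces : all_faces P = (@realize_face R) @` [set` flatten rs].
Proof.
apply/seteqP; split=> [X [r]|_ [G /mem_flatten_nth[[|k] krs Gk] <-]].
- rewrite PE => -[G + <-]; case: r => [k|[|k]] //= Gk; exists G => //=; apply/mem_flatten_nth.
    have [krs|krs] := ltnP k.+1 (size rs); first by exists k.+1.
    by move: Gk; rewrite nth_default.
  by exists 0; rewrite // lt0n; apply: contraTneq Gk => /size0nil ->.
- by exists (Negz 0); rewrite PE; exists G.
- by exists (Posz k); rewrite PE; exists G.
Qed.

Lemma cert_valid G : G \in flatten rs -> valid G.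
Proof. by move: G; apply/allP; have /andP[/and3P[]] := cert. Qed.

Lemma mem_rank_faces r G : G \in rank_faces rs r -> G \in flatten rs.
Proof.
move=> Gr; have : all_faces P (realize_face R G) by exists r; rewrite PE; exists G.
rewrite ranked_all_faces => -[H Hrs /realize_face_inj E].
have rank_valid : valid G.
  case: r Gr => [k|[|k]] //= Gk; apply: cert_valid; apply/mem_flatten_nth.
    have [krs|krs] := ltnP k.+1 (size rs); first by exists k.+1.
    by move: Gk; rewrite nth_default.
  by exists 0; rewrite // lt0n; apply: contraTneq Gk => /size0nil ->.
by rewrite -E //; exact: cert_valid.
Qed.

(** The certificate demands that the faces of rank 0 be all the vertices of Gamma. A symmetry
    therefore permutes these, which makes it a signed permutation; it preserves the finite lists
    because valid faces are determined by their realizations. *)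
Lemma symmetry_acts f : symmetry P f -> exists2 g, g \in gs & acts f g.
Proof.
move=> [isf Pf]; have vtx : nth [::] rs 1 = [seq canon (pred1 v) pred0 | v <- bvertices].
  by have /andP[/and3P[_ /eqP]] := cert.
have P0E : P (Posz 0) = [set Subgraph [set v] set0 | v in @gamma_vertex R].
  have real_vtx v : v \in bvertices ->
      realize_face R (canon (pred1 v) pred0) = Subgraph [set vertex_point R v] set0.
    move=> vb; rewrite realize_face_canon; congr Subgraph.
      by apply/seteqP; split=> [p [w [_ /eqP -> <-]]|p ->] //; exists v; split=> //=.
    by apply/seteqP; split=> // p [e []].
  rewrite PE /= vtx gamma_vertexE; apply/seteqP; split=> [_ [G /mapP[v vb ->] <-]|].
    by exists (vertex_point R v); [exists v|rewrite real_vtx].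
  move=> _ [_ [v vb <-] <-]; exists (canon (pred1 v) pred0); last by rewrite real_vtx.
  by apply/mapP; exists v.
have [|g gP fg] := isometry_acts isf.
  move=> x; have : P (Posz 0) (move f (Subgraph [set point_of R x] set0)).
    rewrite -Pf P0E; exists (Subgraph [set point_of R x] set0) => //.
    by exists (point_of R x) => //; exists x.
  rewrite P0E => -[_ [y /point_ofE ->]] [] /seteqP[/(_ (point_of R y) erefl)[_ -> fx] _] _.
  by exists y.
exists g => //; rewrite mem_filter gP andbT; apply/allP => r /(nthP [::])[k krs <-].
have [q rkE] : exists q, nth [::] rs k = rank_faces rs q.
  by case: k krs => [|k] _; [exists (Negz 0)|exists (Posz k)].
have moveE G : G \in nth [::] rs k -> move f (realize_face R G) = realize_face R (act_face g G).
  by rewrite rkE => /mem_rank_faces/cert_valid; exact: move_realize_face.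
have rk_valid G : G \in nth [::] rs k -> valid G.
  by rewrite rkE => /mem_rank_faces/cert_valid.
apply: (introT andP); split; apply/allP.
  move=> _ /mapP[H Hk ->]; have : P q (move f (realize_face R H)).
    by rewrite -Pf PE -rkE; exists (realize_face R H) => //; exists H.
  rewrite PE -rkE moveE // => -[G Gk /realize_face_inj <- //]; first exact: rk_valid.
  exact: act_face_valid.
move=> G Gk; have : P q (realize_face R G) by rewrite PE -rkE; exists G.
rewrite -Pf PE -rkE => -[_ [H Hk <-]]; rewrite moveE // => /realize_face_inj HG.
apply/mapP; exists H => //; apply/esym/HG; [exact: act_face_valid|exact: rk_valid].
Qed.

Lemma acts_symmetry g : g \in gs -> exists2 f, symmetry P f & acts f g.
Proof.
rewrite mem_filter => /andP[/allP g_rs gP]; have [f isf fg] := acts_exists R gP.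
exists f => //; split=> // r; rewrite PE.
have moveE G : G \in rank_faces rs r -> move f (realize_face R G) = realize_face R (act_face g G).
  by move=> /mem_rank_faces/cert_valid; exact: move_realize_face.
have : all [in rank_faces rs r] (map (act_face g) (rank_faces rs r)) &&
       all [in map (act_face g) (rank_faces rs r)] (rank_faces rs r).
  have gk k : all [in nth [::] rs k] (map (act_face g) (nth [::] rs k)) &&
       all [in map (act_face g) (nth [::] rs k)] (nth [::] rs k).
    have [krs|krs] := ltnP k (size rs); last by rewrite nth_default.
    have := g_rs _ (mem_nth [::] krs); rewrite /=.
    by case: (all _ _).
  by case: r {moveE} => [k|[|k]] //=; exact: gk.
move=> /andP[/allP sub1 /allP sub2]; apply/seteqP; split.
  move=> _ [_ [G Gr <-] <-]; rewrite moveE //; exists (act_face g G) => //.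
  by apply: sub1; apply/mapP; exists G.
move=> _ [G /sub2/mapP[H Hr ->] <-]; by rewrite -moveE //; exists (realize_face R H) => //; exists H.
Qed.

Let realized (s : seq face) : set (subgraph R) := realize (@realize_face R) s.

Lemma cert_flagP C : flag P C <-> exists2 s, s \in flags face_le rs & C = realized s.
Proof.
have /andP[/and3P[_ _ gr] _] := cert.
apply: (flagP face_le_refl face_le_trans _ ranked_all_faces gr).
by move=> G H /cert_valid vG /cert_valid; exact: realize_face_le.
Qed.

Lemma flags_flatten s : s \in flags face_le rs -> {subset s <= flatten rs}.
Proof.
rewrite mem_flags => /andP[_ s_ranks] G Gs.
have [ss nthP] := all2_mem_nth G s_ranks.
have krs : index G s < size rs by rewrite -ss index_mem.
by apply/mem_flatten_nth; exists (index G s) => //; have := nthP _ krs; rewrite nth_index.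
Qed.

Lemma move_realized f g s : g \in gs -> acts f g -> {subset s <= flatten rs} ->
  move f @` realized s = realized (map (act_face g) s).
Proof.
rewrite mem_filter => /andP[_ gP] fg s_rs; apply/seteqP; split.
  move=> _ [_ [G Gs <-] <-]; rewrite (move_realize_face gP) ?cert_valid ?s_rs //.
  by exists (act_face g G) => //=; apply: map_f.
move=> _ [_ /mapP[G Gs ->] <-]; exists (realize_face R G); first by exists G.
by rewrite (move_realize_face gP) ?cert_valid ?s_rs.
Qed.

Lemma adjacent_almost_included s s' :
  {subset s <= flatten rs} -> {in s', forall G, valid G} ->
  adjacent_flags (realized s) (realized s') -> almost_included s s'.
Proof.
move=> s_rs vs' [F [_ [sF _]]].
have inF G : G \in s -> G \notin s' -> realize_face R G = F.
  move=> Gs /negP Gs'; have : (realized s `\` realized s') (realize_face R G); last by rewrite sF.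
  split; first by exists G.
  move=> [H Hs' /realize_face_inj E]; apply: Gs'.
  by rewrite -(E (vs' _ Hs') (cert_valid (s_rs _ Gs))).
have [_ ] : (realized s `\` realized s') F by rewrite sF.
have [[G Gs <-] NG] : (realized s `\` realized s') F by rewrite sF.
have GD : G \in [seq G <- s | G \notin s'].
  by rewrite mem_filter Gs andbT; apply/negP => Gs'; apply: NG; exists G.
move=> _; rewrite /almost_included.
have /perm_size -> // : perm_eq (undup [seq G <- s | G \notin s']) [:: G].
apply: uniq_perm; rewrite ?undup_uniq // => H; rewrite mem_undup inE.
apply/idP/eqP => [|-> //]; rewrite mem_filter => /andP[Hs' Hs].
move: GD; rewrite mem_filter => /andP[Gs' _].
by apply: (@realize_face_inj R); rewrite ?inF // cert_valid ?s_rs.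
Qed.

Lemma orbit_acts g s : g \in gs -> {subset s <= flatten rs} ->
  Defs.orbit P (realized (map (act_face g) s)) = Defs.orbit P (realized s).
Proof.
move=> /[dup] gP /acts_symmetry[f sf fg] s_rs.
by rewrite -(move_realized gP fg s_rs) orbit_move.
Qed.

Lemma orbit_realizedP s D : {subset s <= flatten rs} -> Defs.orbit P (realized s) D ->
  exists2 g, g \in gs & D = realized (map (act_face g) s).
Proof.
move=> s_rs [f /[dup] sf /symmetry_acts[g gP fg] <-]; exists g => //.
exact: move_realized.
Qed.

(* Moving one of two adjacent flags in the same orbit onto C1 or C2 moves the
   other one onto a flag adjacent to C1 or C2. *)
Lemma certificate_chiral : geometrically_chiral P.
Proof.
have /andP[_ /and4P[/and3P[C1P C2P /allP cover] /allP N12 /allP N1 /allP N2]] := cert.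
have C1_rs := flags_flatten C1P; have C2_rs := flags_flatten C2P.
have flag1 : flag P (realized C1) by apply/cert_flagP; exists C1.
have flag2 : flag P (realized C2) by apply/cert_flagP; exists C2.
have im_valid g s : {in map (act_face g) s, forall G, valid G}.
  by move=> _ /mapP[G _ ->]; exact: act_face_valid.
have im_flag C : flag P C -> exists s g, [/\ s = C1 \/ s = C2, g \in gs &
    C = realized (map (act_face g) s)].
  move=> /cert_flagP[s /cover /orP[/mapP[g gP ->]|/mapP[g gP ->]] ->].
    by exists C1, g; split; auto.
  by exists C2, g; split; auto.
have rs12 s : s = C1 \/ s = C2 -> {subset s <= flatten rs} by move=> [->|->].
split.
  exists (Defs.orbit P (realized C1)), (Defs.orbit P (realized C2)); split.
    (* If the orbits were equal, some image of [C1] would contain every face of [C2]. *)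
    move=> E; have := orbit_refl P (realized C2); rewrite -E => /orbit_realizedP.
    move=> /(_ C1_rs)[g gP EC]; have /negP := N12 _ (map_f (fun g => map (act_face g) C1) gP).
    apply; apply/allP => G GC2; have : realized C2 (realize_face R G) by exists G.
    rewrite EC => -[H Hg /realize_face_inj <- //]; first exact: im_valid Hg.
    by rewrite cert_valid ?C2_rs.
  apply/seteqP; split=> [_ [C fC <-]|_ [->|->]]; last 2 first.
  - by exists (realized C1).
  - by exists (realized C2).
  have [s [g [s12 gP ->]]] := im_flag _ fC; rewrite orbit_acts //; last exact: rs12.
  by case: s12 => ->; [left|right].
move=> C D fC fD CD E.
have [s [g [s12 gP CE]]] := im_flag _ fC; have s_rs := rs12 _ s12.
have [f sf fg] := acts_symmetry gP; have [h [sh fK hK]] := symmetry_inv sf.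
have hC : move h @` C = realized s.
  by rewrite CE -(move_realized gP fg s_rs) image_comp -[RHS]image_id; apply: eq_imagel => G _ /=.
have : Defs.orbit P (realized s) (move h @` D).
  by rewrite -hC orbit_move // E -(orbit_move D sh); exact: orbit_refl.
move=> /(orbit_realizedP s_rs)[g' gP' DE].
have /(_ _ (im_valid g' s)) := adjacent_almost_included s_rs.
rewrite -/realized -hC -DE => /(_ (adjacent_flags_move (can_inj hK) CD)).
case: s12 => ->.
- by apply/negP/N1/(map_f (fun g => map (act_face g) C1)).
- by apply/negP/N2/(map_f (fun g => map (act_face g) C2)).
Qed.

End Chirality.

(** * Colourings and their components *)

Section Recolouring.
Variables (R : realType) (c : set (proj3 R) -> 'I_4).

(** A renaming permutes the sets of [n] colours, and the subgraph of [S] for the renamed colouring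
    is that of the preimage of [S] for the original one. *)
Lemma colour_component_recolour (s : 'I_4 -> 'I_4) n : injective s ->
  colour_component (s \o c) n = colour_component c n.
Proof.
move=> s_inj; have subgraphE (S : {set 'I_4}) :
    colour_subgraph (s \o c) S = colour_subgraph c (s @^-1: S)%SET.
  by rewrite /colour_subgraph; congr edge_induced; apply: eq_set => e; rewrite inE.
apply/seteqP; split=> F [S [Sn SF]].
  by exists (s @^-1: S)%SET; rewrite card_preimset // -subgraphE.
exists (s @: S)%SET; rewrite card_imset // subgraphE; split=> //.
by have -> : (s @^-1: (s @: S))%SET = S by apply/setP => i; rewrite inE mem_imset.
Qed.

Lemma Qface_recolour (s : 'I_4 -> 'I_4) r : injective s -> Qface (s \o c) r = Qface c r.
Proof. by move=> s_inj; case: r => [[|[|[|[|k]]]]|k] //=; exact: colour_component_recolour. Qed.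

Hypothesis hc : chiral_colouring c.

Lemma chiral_colouring_proper e e' : e \in bedges -> e' \in bedges ->
  e != e' -> conflict e e' -> c (@edge_segment R e) != c (@edge_segment R e').
Proof.
move=> eb eb' ne cf; apply: contra ne => /eqP cee'; apply/eqP.
have gamma_re e1 : e1 \in bedges -> gamma_edge (@edge_segment R e1).
  by move=> e1b; rewrite gamma_edgeE; exists e1.
have [match_c dir_c] := hc (c (@edge_segment R e)); apply: (@edge_segment_inj R) => //.
case/orP: cf => [/eqP dir_e|/hasP[v ve ve']].
  have [E [_ EU]] := dir_c (Ordinal (bedges_dir eb)).
  have <- : E = @edge_segment R e.
    by apply: EU; split; [split=> //; exact: gamma_re|apply/edge_in_directionP; exists e].
  apply: EU; split; first by split; rewrite //; exact: gamma_re.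
  by apply/edge_in_directionP; exists e'; rewrite -dir_e.
have vb := ends_bvertices eb ve; have gv : gamma_vertex (vertex_point R v).
  by rewrite gamma_vertexE; exists v.
have [E [_ EU]] := match_c.2 _ gv.
have <- : E = @edge_segment R e.
  by apply: EU; split; [split=> //; exact: gamma_re|apply/edge_segment_ends].
by apply: EU; split; [split=> //; exact: gamma_re|apply/edge_segment_ends].
Qed.

(** The four edges at (1, 1, 1, 1) are pairwise in conflict, so mapping a direction to the colour of
    its edge there is a bijection; [s] is its inverse. The renamed colouring is still proper for
    [conflict], hence found by the search. *)
Lemma normalized_colouring_exists : exists (s : 'I_4 -> 'I_4) p, [/\ injective s,
  p \in normalized_colourings &
  {in bedges, forall e, s (c (@edge_segment R e)) = colour_of p e :> nat}].
Proof.
have base_b (i : 'I_4) : (nseq 4 false, i : nat) \in bedges.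
  by case: i; do 4?[case=> //].
pose d (i : 'I_4) : 'I_4 := c (@edge_segment R (nseq 4 false, i : nat)).
have d_inj : injective d.
  move=> i j /eqP dij; apply/eqP; apply: contraTT dij => ij.
  apply: (chiral_colouring_proper (base_b i) (base_b j)).
    by apply: contraNneq ij => -[/val_inj ->].
  by apply/orP; right; apply/hasP; exists (nseq 4 false); exact: mem_head.
pose col e : nat := invF d_inj (c (@edge_segment R e)).
pose q := catrev [seq e <- bedges | e.1 != nseq 4 false] base_edges.
have base_sub : {subset [seq e <- bedges | e.1 != nseq 4 false] ++ base_edges <= bedges}.
  by move=> e; rewrite mem_cat !mem_filter -andb_orl => /andP[].
exists (invF d_inj), [seq (e, col e) | e <- q]; split.
- by apply: (can_inj (g := d)); exact: f_invF.
- rewrite /normalized_colourings.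
  have -> : [seq (e, e.2) | e <- base_edges] = [seq (e, col e) | e <- base_edges].
    apply/eq_in_map => -[v i]; rewrite mem_filter => /andP[/eqP /= -> /bedges_dir i4].
    by rewrite /col -[c _]/(d (Ordinal i4)) invF_f.
  apply: mem_extensions => [//|e _|e e' /base_sub eb /base_sub eb' ne cf]; first exact: ltn_ord.
  rewrite (inj_eq val_inj) (inj_eq (can_inj (f_invF d_inj))).
  exact: chiral_colouring_proper.
- move=> e eb; have eq : e \in q.
    rewrite /q catrevE mem_cat mem_rev -mem_cat mem_cat !mem_filter eb !andbT.
    exact: orNb.
  rewrite /colour_of /unzip1 /unzip2 -!map_comp map_id.
  by rewrite (nth_map ([::], 0)) ?index_mem //= nth_index.
Qed.

End Recolouring.

Section Components.
Variables (R : realType) (c : set (proj3 R) -> 'I_4) (col : seq bool * nat -> nat).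
Hypothesis colE : {in bedges, forall e, c (@edge_segment R e) = col e :> nat}.

Definition mask (S : {set 'I_4}) : seq bool := [seq k \in S | k <- enum 'I_4].

Lemma count_mask (S : {set 'I_4}) : count id (mask S) = #|S|.
Proof. by rewrite count_map enumT cardE /enum_mem size_filter. Qed.

Lemma mask_masks (S : {set 'I_4}) n : #|S| = n -> mask S \in masks n.
Proof.
move=> Sn; rewrite mem_filter bits_size size_map size_enum_ord eqxx andbT.
by rewrite count_mask Sn.
Qed.

Lemma masks_mask n M : M \in masks n -> exists2 S : {set 'I_4}, #|S| = n & mask S = M.
Proof.
rewrite mem_filter bits_size => /andP[/eqP Mn /eqP sM].
have E : mask [set k : 'I_4 | nth false M k]%SET = M.
  apply: (@eq_from_nth _ false); rewrite size_map size_enum_ord ?sM // => i i4.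
  by rewrite (nth_map ord0) ?size_enum_ord // inE nth_enum_ord.
by exists [set k : 'I_4 | nth false M k]%SET; rewrite // -count_mask E.
Qed.

Lemma nth_mask (S : {set 'I_4}) e : e \in bedges -> nth false (mask S) (col e) = (c (@edge_segment R e) \in S).
Proof.
move=> eb; rewrite -colE // (nth_map ord0) ?size_enum_ord //.
by congr (_ \in S); apply: val_inj; rewrite /= nth_enum_ord.
Qed.

Section Component.
Variables (S : {set 'I_4}).
Let D := coloured_edges col (mask S).
Hypothesis D_span : {in bvertices, forall v, has (fun e => v \in ends e) D}.

Let D_bedges e : e \in D -> e \in bedges.
Proof. by rewrite mem_filter => /andP[]. Qed.

Let mem_D e : e \in bedges -> (e \in D) = (c (@edge_segment R e) \in S).
Proof. by move=> eb; rewrite mem_filter eb andbT nth_mask. Qed.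

Lemma colour_subgraphE :
  colour_subgraph c S = Subgraph (vertex_point R @` [set` bvertices]) (@edge_segment R @` [set` D]).
Proof.
have edgesE : [set e | gamma_edge e /\ c e \in S] = @edge_segment R @` [set` D].
  rewrite gamma_edgeE; apply/seteqP; split=> [_ [[e eb <-] eS]|_ [e eD <-]].
    by exists e => //; exact: etrans (mem_D eb) eS.
  have eb := D_bedges eD; split; first by exists e.
  by rewrite -mem_D.
rewrite /colour_subgraph /edge_induced edgesE; congr Subgraph; rewrite gamma_vertexE.
apply/seteqP; split=> [v [] //|_ [v vb <-]]; split; first by exists v.
have /hasP[e eD ve] := D_span vb; exists (@edge_segment R e); first by exists e.
by apply/edge_segment_ends; rewrite // D_bedges.
Qed.

Lemma adjacentP (v w : proj3 R) : adjacent (colour_subgraph c S) v w <->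
  exists x y e, [/\ e \in D, x \in ends e, y \in ends e, vertex_point R x = v & vertex_point R y = w].
Proof.
rewrite colour_subgraphE; split.
  move=> [[x xb <-] [y yb <-] [_ [[e eD <-] xe ye]]]; exists x, y, e.
  have eb := D_bedges eD.
  by split=> //; [apply/(@edge_segment_ends R _ _ xb eb)|apply/(@edge_segment_ends R _ _ yb eb)].
move=> [x [y [e [eD xe ye <- <-]]]]; have eb := D_bedges eD.
have [xb yb] := (ends_bvertices eb xe, ends_bvertices eb ye).
by split; [exists x|exists y|exists (@edge_segment R e); split; [exists e|exact/edge_segment_ends..]].
Qed.

Lemma mem_grow W w : w \in grow D W <-> w \in bvertices /\
  (w \in W \/ exists u e, [/\ e \in D, u \in W, u \in ends e & w \in ends e]).
Proof.
rewrite mem_filter; split=> [/andP[/orP[wW|/hasP[e eD /andP[we /hasP[u ue uW]]]] wb]|].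
- by split; auto.
- by split=> //; right; exists u, e.
- move=> [-> [->//|[u [e [eD uW ue we]]]]]; rewrite andbT; apply/orP; right.
  by apply/hasP; exists e; rewrite // we; apply/hasP; exists u.
Qed.

(** Each application of [grow] follows at most one further edge, so only connected vertices are
    reached. Conversely a fixed point of [grow] cannot be left along an edge. *)
Lemma connectedP v (p : proj3 R) : v \in bvertices -> grow D (reach D v) = reach D v ->
  connected (colour_subgraph c S) (vertex_point R v) p <->
  exists2 w, w \in reach D v & vertex_point R w = p.
Proof.
move=> vb closedW; split; last first.
  move=> [w + <-]; rewrite /reach; elim: 3 w => [|n IH] w.
    by rewrite inE => /eqP ->; exact: rt_refl.
  rewrite iterS => /mem_grow[_ [/IH//|[u [e [eD uW ue we]]]]].
  apply: rt_trans (IH _ uW) _; apply: rt_step; apply/adjacentP.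
  by exists u, w, e.
have vW n : v \in iter n (grow D) [:: v].
  by elim: n => [|n IH]; rewrite ?mem_head // iterS; apply/mem_grow; auto.
have closed_conn x y : connected (colour_subgraph c S) x y ->
    (exists2 w, w \in reach D v & vertex_point R w = x) ->
    exists2 w, w \in reach D v & vertex_point R w = y.
  elim=> {x y} [x y /adjacentP[x' [y' [e [eD xe ye <- <-]]]] [w wW wx]| //|x y z _ IH1 _ IH2].
    exists y' => //; rewrite -closedW; apply/mem_grow; have eb := D_bedges eD.
    split; first exact: ends_bvertices ye.
    right; exists x', e; split=> //; rewrite -(@vertex_point_inj R w x') //; last exact: ends_bvertices xe.
    by move: wW; rewrite -closedW => /mem_grow[].
  by move=> /IH1/IH2.
by move=> /closed_conn; apply; exists v => //; exact: vW.
Qed.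

Hypothesis D_closed : {in bvertices, forall v, grow D (reach D v) = reach D v}.

Lemma componentP F : component (colour_subgraph c S) F <->
  exists2 v, v \in bvertices & realize_face R (component_face col (mask S) v) = F.
Proof.
have faceE v : v \in bvertices -> realize_face R (component_face col (mask S) v) =
    Subgraph [set w | connected (colour_subgraph c S) (vertex_point R v) w]
      [set e | edges (colour_subgraph c S) e /\
               exists2 w, connected (colour_subgraph c S) (vertex_point R v) w & e w].
  move=> vb; have closedW := D_closed vb.
  rewrite realize_face_canon -/D; congr Subgraph; apply/seteqP; split.
  - by move=> _ [w [wb wW <-]]; apply/connectedP => //; exists w.
  - move=> p /(connectedP _ vb closedW)[w wW <-]; exists w; split=> //.
    by move: wW; rewrite -closedW => /mem_grow[].
  - move=> _ [e [eb /andP[eD /hasP[w we wW]] <-]]; split.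
      by rewrite colour_subgraphE; exists e.
    exists (vertex_point R w); first by apply/connectedP => //; exists w.
    by apply/edge_segment_ends => //; exact: ends_bvertices we.
  - move=> E []; rewrite {1}colour_subgraphE => -[e eD <-] [_ /(connectedP _ vb closedW)[w wW <-] we].
    have eb := D_bedges eD; exists e; split=> //.
    apply/andP; split=> //; apply/hasP; exists w => //.
    have wb : w \in bvertices by move: wW; rewrite -closedW => /mem_grow[].
    exact/(@edge_segment_ends R _ _ wb eb).
split=> [[p]|[v vb <-]]; last first.
  by exists (vertex_point R v); rewrite ?faceE // colour_subgraphE; exists v.
by rewrite {1}colour_subgraphE => -[v vb <-] ->; exists v; rewrite ?faceE.
Qed.

End Component.

Lemma colour_componentE n : saturated col n ->
  colour_component c n = realize_face R @` [set` component_faces col n].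
Proof.
move=> /allP sat; have satP (S : {set 'I_4}) : #|S| = n ->
    let D := coloured_edges col (mask S) in
    {in bvertices, forall v, has (fun e => v \in ends e) D} /\
    {in bvertices, forall v, grow D (reach D v) = reach D v}.
  by move=> /mask_masks/sat/allP satS; split=> v /satS /andP[] // _ /eqP.
apply/seteqP; split=> [F [S [Sn]]|_ [G + <-]].
  have [span sat_S] := satP _ Sn; move/(componentP span sat_S) => [v vb <-].
  exists (component_face col (mask S) v) => //=.
  by rewrite mem_undup; apply/allpairsP; exists (mask S, v); split=> //; exact: mask_masks.
rewrite /= mem_undup => /allpairsP[[M v] [/= /masks_mask[S Sn <-] vb ->]].
have [span sat_S] := satP _ Sn; exists S; split=> //; apply/(componentP span sat_S).
by exists v.
Qed.

Lemma realize_vertex_face v : v \in bvertices ->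
  realize_face R (canon (pred1 v) pred0) = Subgraph [set vertex_point R v] set0.
Proof.
move=> vb; rewrite realize_face_canon; congr Subgraph.
  by apply/seteqP; split=> [p [w [_ /eqP -> <-]]|p ->] //; exists v; split=> //=.
by apply/seteqP; split=> // p [e []].
Qed.

Lemma realize_edge_face e : e \in bedges ->
  realize_face R (canon [in ends e] (pred1 e)) = edge_induced [set @edge_segment R e].
Proof.
move=> eb; rewrite realize_face_canon; congr Subgraph; apply/seteqP; split.
- move=> _ [v [vb ve <-]]; split; first by rewrite gamma_vertexE; exists v.
  by exists (@edge_segment R e) => //; apply/edge_segment_ends.
- move=> p []; rewrite gamma_vertexE => -[v vb <-] [_ -> /edge_segment_ends ve].
  by exists v; split=> //; exact: ve.
- by move=> _ [e' [_ /eqP -> <-]].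
- by move=> _ ->; exists e; split=> //=.
Qed.

Lemma Qface_ranks r : saturated col 2 -> saturated col 3 ->
  Qface c r = realize_face R @` [set` rank_faces (ranks col) r].
Proof.
move=> sat2 sat3; have image1 G : realize_face R @` [set` [:: G]] = [set realize_face R G].
  apply/seteqP; split=> [_ [H /= + <-]|_ ->]; first by rewrite inE => /eqP ->.
  by exists G; rewrite //= mem_head.
have image0 : realize_face R @` [set` [::]] = set0 by apply/seteqP; split=> // F [].
have vertexE : Qface c (Posz 0) =
    realize_face R @` [set` [seq canon (pred1 v) pred0 | v <- bvertices]].
  rewrite /Qface gamma_vertexE; apply/seteqP.
  split=> [_ [_ [v vb <-] <-]|_ [_ /mapP[v vb ->] <-]].
    by rewrite -realize_vertex_face //; exists (canon (pred1 v) pred0) => //; apply/mapP; exists v.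
  by rewrite realize_vertex_face //; exists (vertex_point R v) => //; exists v.
have edgeE : Qface c (Posz 1) =
    realize_face R @` [set` [seq canon [in ends e] (pred1 e) | e <- bedges]].
  rewrite /Qface gamma_edgeE; apply/seteqP.
  split=> [_ [_ [e eb <-] <-]|_ [_ /mapP[e eb ->] <-]].
    rewrite -realize_edge_face //; exists (canon [in ends e] (pred1 e)) => //.
    by apply/mapP; exists e.
  by rewrite realize_edge_face //; exists (@edge_segment R e) => //; exists e.
case: r => [[|[|[|[|[|k]]]]]|[|k]].
- exact: vertexE.
- exact: edgeE.
- exact: colour_componentE.
- exact: colour_componentE.
- have -> : rank_faces (ranks col) (Posz 4) = [:: canon predT predT] by [].
  rewrite image1; congr set1; rewrite realize_face_canon /gamma gamma_vertexE gamma_edgeE.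
  congr Subgraph; apply/seteqP; split=> p.
  + by move=> [v vb <-]; exists v.
  + by move=> [v [vb _ <-]]; exists v.
  + by move=> [v vb <-]; exists v.
  + by move=> [v [vb _ <-]]; exists v.
- by rewrite /rank_faces nth_default // image0.
- have -> : rank_faces (ranks col) (Negz 0) = [:: canon pred0 pred0] by [].
  rewrite image1; congr set1; rewrite realize_face_canon; congr Subgraph.
    by apply/seteqP; split=> // p [v []].
  by apply/seteqP; split=> // p [v []].
- by rewrite image0.
Qed.

End Components.

(** * The face poset of the hemi-hypercube *)

(** Both posets are copies of the index list ordered by [leI]: if [a i = a j], then [leI] holds both
    ways and [i = j], and likewise for [b]. Hence sending [a i] to [b i] is well defined and
    bijective. The element of [U] gives the values elsewhere. *)
Lemma poset_isomorphic_index (I : eqType) (L : seq I) (leI : rel I)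
    (T U : Type) (leT : T -> T -> Prop) (leU : U -> U -> Prop) (a : I -> T) (b : I -> U) :
  (forall i, i \in L -> leI i i) ->
  {in L &, forall i j, leI i j && leI j i -> i = j} ->
  {in L &, forall i j, leT (a i) (a j) <-> leI i j} ->
  {in L &, forall i j, leU (b i) (b j) <-> leI i j} -> U ->
  poset_isomorphic (a @` [set` L]) leT (b @` [set` L]) leU.
Proof.
move=> leI_refl leI_anti aE bE u0.
have a_inj : {in L &, injective a}.
  move=> i j iL jL aij; apply: leI_anti => //; apply/andP.
  by split; apply/aE => //; rewrite -?aij ?aij; apply/aE => //; exact: leI_refl.
have b_inj : {in L &, injective b}.
  move=> i j iL jL bij; apply: leI_anti => //; apply/andP.
  by split; apply/bE => //; rewrite -?bij ?bij; apply/bE => //; exact: leI_refl.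
have /choice[f fE] x : exists u, forall i, i \in L -> a i = x -> b i = u.
  have [[i iL ax]|no] := pselect (exists2 i, i \in L & a i = x).
    by exists (b i) => j jL ax'; congr b; apply: a_inj; rewrite // ax ax'.
  by exists u0 => i iL ax; case: no; exists i.
have fa i : i \in L -> f (a i) = b i by move=> iL; apply/esym/fE.
exists f; split; last by move=> _ _ [i iL <-] [j jL <-]; rewrite !fa // bE // aE.
split.
- by move=> _ [i iL <-]; rewrite /= fa //; exists i.
- move=> _ _ /set_mem[i iL <-] /set_mem[j jL <-]; rewrite !fa // => /b_inj.
  by move=> /(_ iL jL) ->.
- by move=> _ [i iL <-]; exists (a i); [exists i|rewrite fa].
Qed.

Definition code_fun (s : seq (option bool)) : {ffun 'I_4 -> option bool} :=
  [ffun i : 'I_4 => nth None s i].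

Lemma codes_size s : (s \in codes) = (size s == 4).
Proof. by rewrite mem_words andb_idr // => _; apply/allP => -[[]|]. Qed.

Lemma code_fun_surj (s : {ffun 'I_4 -> option bool}) : exists2 t, t \in codes & code_fun t = s.
Proof.
exists (mkseq (fun k => s (inord k)) 4); first by rewrite codes_size size_mkseq.
by apply/ffunP => i; rewrite ffunE nth_mkseq // inord_val.
Qed.

Lemma antipodeK : involutive antipode.
Proof. by move=> x; apply/ffunP => i; rewrite !ffunE negbK. Qed.

Lemma antipode_imset (F : {set signs}) x : (x \in [set antipode y | y in F]%SET) = (antipode x \in F).
Proof.
apply/imsetP/idP => [[y yF ->]|xF]; first by rewrite antipodeK.
by exists (antipode x); rewrite ?antipodeK.
Qed.

Lemma code_opp_codes s : s \in codes -> code_opp s \in codes.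
Proof. by rewrite !codes_size size_map. Qed.

Lemma subcube_opp s : s \in codes ->
  subcube (code_fun (code_opp s)) = [set antipode x | x in subcube (code_fun s)]%SET.
Proof.
rewrite codes_size => /eqP ss; apply/setP => x; rewrite antipode_imset !inE.
apply: eq_forallb => i; rewrite !ffunE (nth_map None) ?ss //.
by case: nth => [b|] //=; case: b (x i) => [] [].
Qed.

Lemma antipodal_class_opp (F : {set signs}) :
  antipodal_class [set antipode x | x in F]%SET = antipodal_class F.
Proof.
rewrite /antipodal_class.
have -> : [set antipode x | x in [set antipode x | x in F]]%SET = F.
  by apply/setP => x; rewrite !antipode_imset antipodeK.
exact: finset.setUC.
Qed.

Lemma subset_subcube s t : s \in codes -> t \in codes ->
  (subcube (code_fun s) \subset subcube (code_fun t)) = code_le s t.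
Proof.
rewrite !codes_size => /eqP ss /eqP st.
have -> : code_le s t = [forall i : 'I_4, (nth None t i == None) || (nth None t i == nth None s i)].
  rewrite /code_le all2E ss st eqxx /=; apply/allP/forallP => [H i|H [x y]].
    have /H : (nth None s i, nth None t i) \in zip s t.
      by rewrite -nth_zip ?ss ?st // mem_nth // size_zip ss st.
    by [].
  move=> /(nthP (None, None))[i]; rewrite size_zip ss st => i4.
  by rewrite nth_zip ?ss ?st // => -[<- <-]; exact: (H (Ordinal i4)).
apply/fintype.subsetP/forallP => [H i|H x]; last first.
  rewrite !inE => /forallP sx; apply/forallP => i; have := H i; have := sx i.
  by rewrite !ffunE; case: (nth None t i) => [b|] //= /orP[/eqP -> //|/eqP ->].
(* This vertex of the face [s] violates every condition of [t] on a coordinate that [s] leaves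
   free. *)
pose x : signs := [ffun j : 'I_4 => if nth None s j is Some b then b
                     else if nth None t j is Some b then ~~ b else false].
have /H : x \in subcube (code_fun s).
  by rewrite inE; apply/forallP => j; rewrite !ffunE; case: (nth None s j) => //= b; rewrite eqxx.
rewrite inE => /forallP/(_ i); rewrite !ffunE.
by case: (nth None t i) => [b|] //=; case: (nth None s i) => [b'|] //=; case: b.
Qed.

(** The antipodal map preserves inclusions, so the four choices of representatives reduce to two. *)
Lemma hemicube_leP (F G : {set signs}) : hemicube_le (antipodal_class F) (antipodal_class G) <->
  F \subset G \/ F \subset [set antipode x | x in G]%SET.
Proof.
pose opp (F : {set signs}) := [set antipode x | x in F]%SET.
have oppK : involutive opp by move=> F'; apply/setP => x; rewrite !antipode_imset antipodeK.
have oppS (F' G' : {set signs}) : F' \subset G' -> opp F' \subset opp G' by exact: imsetS.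
have classE (F' X : {set signs}) : (X \in antipodal_class F') = (X == F') || (X == opp F').
  by rewrite !inE.
split=> [[X [Y []]]|[FG|FG]].
- rewrite !classE => /orP[]/eqP -> /orP[]/eqP ->; auto.
    by move=> /oppS; rewrite !oppK; auto.
  by move=> /oppS; rewrite !oppK; auto.
- by exists F, G; rewrite !classE !eqxx.
- by exists F, (opp G); rewrite !classE !eqxx orbT.
Qed.

Definition hemi_class (s : option (seq (option bool))) : {set {set signs}} :=
  antipodal_class (if s is Some t then subcube (code_fun t) else finset.set0).

Lemma hemi_class_le : {in code_reps &, forall s t,
  hemicube_le (hemi_class s) (hemi_class t) <-> hemi_le s t}.
Proof.
move=> [s|] [t|] sr tr; rewrite hemicube_leP ?finset.sub0set /=; try by split; auto.
- have [sc tc] := (code_reps_codes sr, code_reps_codes tr).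
  rewrite -subcube_opp // !subset_subcube ?code_opp_codes //.
  by split=> [/orP|/orP].
- split=> //; suff : subcube (code_fun s) != finset.set0.
    rewrite imset0 finset.subset0 => /negbTE ->; by case.
  have [sc] := code_reps_codes sr; apply/finset.set0Pn.
  exists [ffun i : 'I_4 => nth None s i == Some true]; rewrite inE; apply/forallP => i.
  by rewrite !ffunE; case: (nth None s i) => [[]|].
Qed.

Lemma hemicube_faceE : hemicube_face = hemi_class @` [set` code_reps].
Proof.
apply/seteqP; split=> [_ [F [->|[s ->]] <-]|_ [[s|] sr <-]].
- by exists None => //; exact: mem_head.
- have [t tc <-] := code_fun_surj s; have /orP[tr|tr] := code_reps_complete tc.
    by exists (Some t).
  by exists (Some (code_opp t)); rewrite // /hemi_class subcube_opp // antipodal_class_opp.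
- by exists (subcube (code_fun s)) => //; right; exists (code_fun s).
- by exists finset.set0 => //; left.
Qed.

Lemma rank_faces_facet rs G r :
  size rs = 6 -> all (fun H => ~~ face_le H G) (nth [::] rs 5) ->
  rank_faces (facet_ranks rs G) r = [seq H <- rank_faces rs r | face_le H G].
Proof.
move=> rs6 /allP topN; have s5 : size (take 5 rs) = 5 by rewrite size_takel ?rs6.
have nthE k : nth [::] (facet_ranks rs G) k = [seq H <- nth [::] rs k | face_le H G].
  have [k5|k5] := ltnP k 5; first by rewrite (nth_map [::]) ?s5 // nth_take.
  rewrite nth_default ?size_map ?s5 //; apply/esym/eqP.
  rewrite -size_eq0 size_filter -leqn0 leqNgt -has_count; apply/hasPn => H.
  by move: k5; rewrite leq_eqVlt => /predU1P[<- /topN //|k6]; rewrite nth_default ?rs6.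
by case: r => [k|[|k]]; first exact: nthE; first exact: nthE.
Qed.

(** * From the checked models to the polytopes *)

Section Models.
Variables (R : realType) (rs : seq (seq face)).
Implicit Type P : int -> set (subgraph R).

Lemma chiral_model_valid G : chiral_model rs -> G \in flatten rs -> valid G.
Proof. by move=> chir; exact: (cert_valid chir). Qed.

Lemma chiral_model_chiral P : (forall r, P r = realize_face R @` [set` rank_faces rs r]) ->
  chiral_model rs -> geometrically_chiral P.
Proof. by move=> PE chir; exact: (certificate_chiral PE chir). Qed.

Lemma code_model_isomorphic P a :
  (forall r, P r = realize_face R @` [set` rank_faces rs r]) ->
  chiral_model rs -> code_model a rs ->
  poset_isomorphic (all_faces P) (@subgraph_le R) hemicube_face hemicube_le.
Proof.
move=> PE chir /and3P[/allP a_rs /allP rs_a /allP a_le].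
have a_code t : t \in code_reps -> a t \in flatten rs.
  by move=> tr; apply: a_rs; rewrite /unzip2 -map_comp; apply: map_f.
have rsE : realize_face R @` [set` flatten rs] = (realize_face R \o a) @` [set` code_reps].
  apply/seteqP; split=> [_ [G /rs_a + <-]|_ [t tr <-]].
    by rewrite /unzip2 -map_comp => /mapP[t tr ->]; exists t.
  by exists (a t) => //; exact: a_code.
rewrite (ranked_all_faces PE) hemicube_faceE rsE.
apply: (@poset_isomorphic_index _ code_reps hemi_le).
- exact: hemi_le_refl.
- exact: hemi_le_anti.
- move=> t t' tr tr'; apply: (iff_trans (realize_face_le _ _ _)).
  + exact: chiral_model_valid (a_code _ tr).
  + exact: chiral_model_valid (a_code _ tr').
  have /allP/(_ (t', a t')) := a_le _ (map_f _ tr).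
  by rewrite map_f // => /(_ isT)/eqP <-.
- exact: hemi_class_le.
- exact: finset.set0.
Qed.

Lemma facet_model_chiral (c : set (proj3 R) -> 'I_4) G :
  (forall r, Qface c r = realize_face R @` [set` rank_faces rs r]) -> size rs = 6 ->
  chiral_model rs -> G \in nth [::] rs 4 -> facet_model rs G ->
  geometrically_chiral (facet_face c (realize_face R G)).
Proof.
move=> QE rs6 chir G3 /andP[Gtop chirG].
apply: certificate_chiral chirG => r; rewrite rank_faces_facet //.
have rs_valid q H : H \in rank_faces rs q -> valid H.
  by move=> /(mem_rank_faces QE chir); exact: chiral_model_valid.
have vG : valid G by exact: (rs_valid (Posz 3)).
apply/seteqP; split=> [X []|_ [H + <-]].
  rewrite QE => -[H Hr <-] HG; exists H => //; apply: etrans (mem_filter _ _ _) _.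
  by apply/andP; split=> //; apply/(@realize_face_le R _ _ (rs_valid _ _ Hr) vG).
move=> Hm; have /andP[HG Hr] : face_le H G && (H \in rank_faces rs r).
  by rewrite -(mem_filter (face_le^~ G)).
split; first by rewrite QE; exists H.
exact/(@realize_face_le R _ _ (rs_valid _ _ Hr) vG).
Qed.

End Models.

Theorem theorem1 (R : realType) (c : set (proj3 R) -> 'I_4)
    (hc : chiral_colouring c) :
  [/\ poset_isomorphic (all_faces (Qface c)) (@subgraph_le R)
        hemicube_face hemicube_le,
      geometrically_chiral (Qface c) &
      forall F : subgraph R, Qface c (Posz 3) F ->
        geometrically_chiral (facet_face c F)].
Proof.
have [s [p [s_inj pP colE]]] := normalized_colouring_exists hc.
have /allP/(_ _ pP)/and5P[sat2 sat3 iso chir facets] := normalized_colouring_models.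
have QE r : Qface c r = realize_face R @` [set` rank_faces (ranks (colour_of p)) r].
  (* The faces do not depend on the names of the colours, so they can be read from the renamed
     colouring, which agrees with [p]. *)
  by rewrite -(Qface_recolour _ _ s_inj); exact: Qface_ranks.
split.
- exact: code_model_isomorphic QE chir iso.
- exact: chiral_model_chiral QE chir.
move=> F; rewrite QE => -[G G3 <-].
exact: (facet_model_chiral QE (erefl _) chir G3 (allP facets G G3)).
Qed.
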